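(* Let $\kappa\geq\aleph_0$ be a regular cardinal. Then the category $\mathrm{CBorn}^{<\kappa}$ is locally $\kappa$-presentable.
   Context: A disk in a real vector space $V$ is a convex subset $D\subseteq V$ with $tD\subseteq D$ for all $t\in[-1,1]$; its linear span $\langle D\rangle=\mathbb R\cdot D$ carries the gauge semi-norm $\gamma_D(v)=\inf\{r>0\,:\,v\in rD\}$. A base of a complete convex bornology on $V$ is a set $\mathfrak D$ of disks in $V$ with union $V$, closed under $(D',D'')\mapsto D'+D''$ and $D\mapsto rD$ ($r>0$), such that $(\langle D\rangle,\gamma_D)$ is a Banach space for every $D\in\mathfrak D$. Two bases are equivalent if every disk of either one is contained in some disk of the other; a complete convex bornology is an equivalence class of bases; a subset of $V$ is bounded if it is contained in some disk of a base. $\mathrm{CBorn}$ is the category of real vector spaces with a complete convex bornology and linear maps sending bounded subsets to bounded subsets. A Banach space is an object of $\mathrm{CBorn}$ via the base of balls centred at $0$. For a set $S$, $\ell^1(S)$ is the Banach space of absolutely summable families of reals indexed by $S$. A strict epimorphism is a morphism that is a cokernel of some morphism. $\bigoplus$ is the coproduct in $\mathrm{CBorn}$. A cardinal is viewed as the smallest ordinal of its cardinality. For a cardinal $\kappa$, $\mathrm{CBorn}^{<\kappa}\subseteq\mathrm{CBorn}$ is the full subcategory of those $B$ for which there are a set $I$, cardinals $\kappa_i<\kappa$ and a strict epimorphism $\bigoplus_{i\in I}\ell^1(\kappa_i)\to B$ in $\mathrm{CBorn}$. An object $C$ of a category is $\kappa$-presentable if $\mathrm{hom}(C,-)$ preserves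 colimits over $\kappa$-directed posets (posets in which every subset of cardinality $<\kappa$ has an upper bound). A category is locally $\kappa$-presentable if it is cocomplete and has a set of $\kappa$-presentable objects such that every object is a $\kappa$-directed colimit of objects from this set. *)

(* Defs.v *)
From HB Require Import structures.
From mathcomp Require Import all_boot all_order all_algebra.
From mathcomp Require Import finmap unstable all_classical all_reals all_analysis.

Set Implicit Arguments.
Unset Strict Implicit.
Unset Printing Implicit Defensive.

Import Order.TTheory GRing.Theory Num.Theory.
Import numFieldNormedType.Exports.

Local Open Scope classical_set_scope.
Local Open Scope card_scope.
Local Open Scope ring_scope.

(* The universe of sets.  Hom-sets, diagram shapes, index sets and cardinals all
   live in this one universe level (and so do vector spaces, through their
   hom-sets and through the spaces l^1(S)), so that "set" means the same thing
   throughout; a category may have a larger type of objects. *)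
Definition smallType := Type.

(* A cardinal is represented by any set of that cardinality. *)
Definition card_lt (T U : Type) (A : set T) (B : set U) :=
  (A #<= B) /\ ~ (B #<= A).

(* Infinite, and not a sum of fewer than K cardinals smaller than K. *)
Definition regular_cardinal (K : smallType) :=
  ([set: nat] #<= [set: K]) /\
  forall (I : smallType) (F : I -> smallType),
    card_lt [set: I] [set: K] -> (forall i, card_lt [set: F i] [set: K]) ->
    card_lt [set: {i : I & F i}] [set: K].

Record category_on (ob : Type) := CategoryOn {
  hom_on : ob -> ob -> smallType;
  idc_on : forall a, hom_on a a;
  comp_on : forall a b c, hom_on b c -> hom_on a b -> hom_on a c;
  comp1c_on : forall a b (f : hom_on a b), comp_on (idc_on b) f = f;
  compc1_on : forall a b (f : hom_on a b), comp_on f (idc_on a) = f;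
  compA_on : forall a b c d (h : hom_on c d) (g : hom_on b c) (f : hom_on a b),
    comp_on h (comp_on g f) = comp_on (comp_on h g) f }.

Record category := Category { ob :> Type; cat_str : category_on ob }.

Section CategoryOps.
Variable C : category.
Definition hom (a b : C) : smallType := hom_on (cat_str C) a b.
Definition idc (a : C) : hom a a := idc_on (cat_str C) a.
Definition comp (a b c : C) (g : hom b c) (f : hom a b) : hom a c :=
  comp_on g f.
Lemma comp1c (a b : C) (f : hom a b) : comp (idc b) f = f.
Proof. exact: comp1c_on. Qed.
Lemma compc1 (a b : C) (f : hom a b) : comp f (idc a) = f.
Proof. exact: compc1_on. Qed.
Lemma compA (a b c d : C) (h : hom c d) (g : hom b c) (f : hom a b) :
  comp h (comp g f) = comp (comp h g) f.
Proof. exact: compA_on. Qed.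
End CategoryOps.

Record functor (C D : category) := Functor {
  fob :> C -> D;
  fmap : forall a b, hom a b -> hom (fob a) (fob b);
  fmap1 : forall a, fmap (idc a) = idc (fob a);
  fmapM : forall a b c (g : hom b c) (f : hom a b),
    fmap (comp g f) = comp (fmap g) (fmap f) }.

Program Definition functor_comp (C D E : category) (G : functor D E)
    (F : functor C D) : functor C E :=
  @Functor C E (fun a => G (F a)) (fun a b f => fmap G (fmap F f)) _ _.
Next Obligation. by move=> C D E G F a /=; rewrite !fmap1. Qed.
Next Obligation. by move=> C D E G F a b c g f /=; rewrite !fmapM. Qed.

Record cocone (J C : category) (F : functor J C) (X : C) := Cocone {
  leg :> forall j, hom (F j) X;
  legM : forall i j (u : hom i j), comp (leg j) (fmap F u) = leg i }.

Definition is_colimit (J C : category) (F : functor J C) (X : C)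
    (c : cocone F X) :=
  forall (Y : C) (d : cocone F Y),
    exists! h : hom X Y, forall j, comp h (c j) = d j.

Program Definition map_cocone (J C D : category) (F : functor J C) (X : C)
    (G : functor C D) (c : cocone F X) : cocone (functor_comp G F) (G X) :=
  Cocone (leg := fun j => fmap G (c j)) _.
Next Obligation. by move=> J C D F X G c i j u /=; rewrite -fmapM legM. Qed.

Definition preserves_colimits (J C D : category) (G : functor C D) :=
  forall (F : functor J C) (X : C) (c : cocone F X),
    is_colimit c -> is_colimit (map_cocone G c).

Definition is_coproduct (C : category) (I : smallType) (X : I -> C) (P : C)
    (inj : forall i, hom (X i) P) :=
  forall (Y : C) (d : forall i, hom (X i) Y),
    exists! h : hom P Y, forall i, comp h (inj i) = d i.

Definition cocomplete (C : category) :=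
  forall (J : smallType) (Js : category_on J) (F : functor (Category Js) C),
    exists (X : C) (c : cocone F X), is_colimit c.

Program Definition full_subcategory (C : category) (P : C -> Prop) : category :=
  Category (@CategoryOn {X : C | P X}
    (fun X Y => hom (sval X) (sval Y))
    (fun X => idc (sval X))
    (fun X Y Z g f => comp g f) _ _ _).
Next Obligation. by move=> C P a b f; exact: comp1c. Qed.
Next Obligation. by move=> C P a b f; exact: compc1. Qed.
Next Obligation. by move=> C P a b c d h g f; exact: compA. Qed.

Definition set_category : category :=
  Category (@CategoryOn smallType (fun A B => A -> B)
    (fun A x => x) (fun A B C g f x => g (f x))
    (fun _ _ _ => erefl) (fun _ _ _ => erefl) (fun _ _ _ _ _ _ _ => erefl)).

Program Definition hom_functor (C : category) (X : C) :
    functor C set_category :=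
  @Functor C set_category (fun Y => hom X Y) (fun a b g f => comp g f) _ _.
Next Obligation. by move=> C X a; apply/funext => f; exact: comp1c. Qed.
Next Obligation.
by move=> C X a b c g f; apply/funext => h; rewrite /= -compA.
Qed.

(* Not the library's porderType, whose carrier need not range over smallType. *)
Record poset := Poset {
  poset_sort : smallType;
  ple : rel poset_sort;
  ple_refl : reflexive ple;
  ple_anti : antisymmetric ple;
  ple_trans : transitive ple }.

Program Definition poset_category (P : poset) : category :=
  Category (@CategoryOn (poset_sort P) (fun i j => ple i j) (@ple_refl P)
    (fun i j k (g : ple j k) (f : ple i j) => ple_trans f g) _ _ _).
Next Obligation. by move=> *; exact: bool_irrelevance. Qed.
Next Obligation. by move=> *; exact: bool_irrelevance. Qed.
Next Obligation. by move=> *; exact: bool_irrelevance. Qed.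

Definition directed (K : smallType) (P : poset) :=
  forall A : set (poset_sort P), card_lt A [set: K] ->
    exists u, forall a, A a -> ple a u.

Definition presentable (K : smallType) (C : category) (X : C) :=
  forall P : poset, directed K P ->
    @preserves_colimits (poset_category P) C set_category (hom_functor X).

Definition locally_presentable (K : smallType) (C : category) :=
  cocomplete C /\
  exists (I : smallType) (G : I -> C),
    (forall i, presentable K (G i)) /\
    forall X : C, exists (P : poset) (F : functor (poset_category P) C)
      (c : cocone F X),
      [/\ directed K P, forall p, exists i, F p = G i & is_colimit c].

Section Bornology.
Variable R : realType.

Section Disks.
Variable V : lmodType R.
Implicit Types (D : set V) (v : V).

Definition disk D :=
  convex_set (D : set (convex_lmodType V)) /\
  forall t : R, -1 <= t <= 1 -> forall v, D v -> D (t *: v).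

Definition disk_span D : set V :=
  [set v | exists t : R, exists2 d, D d & v = t *: d].

Definition gauge D v : R :=
  inf [set r : R | 0 < r /\ exists2 d, D d & v = r *: d].

(* The linear span equipped with the gauge is a Banach space: the gauge, which
   is automatically a semi-norm, is definite, and Cauchy sequences converge.
   The first clause only excludes the empty disk, for which R.D is not a
   linear subspace. *)
Definition banach_disk D :=
  [/\ disk_span D 0,
      forall v, disk_span D v -> gauge D v = 0 -> v = 0 &
      forall x : nat -> V, (forall n, disk_span D (x n)) ->
        (forall e : R, 0 < e -> exists N : nat, forall m n : nat,
          (N <= m)%N -> (N <= n)%N -> gauge D (x m - x n) < e) ->
        exists2 l, disk_span D l & forall e : R, 0 < e ->
          exists N : nat, forall n : nat, (N <= n)%N -> gauge D (x n - l) < e].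

Record is_base (B : set (set V)) : Prop := IsBase {
  base_disk : forall D, B D -> disk D;
  base_cover : forall v, exists2 D, B D & D v;
  base_add : forall D D', B D -> B D' ->
    B [set v | exists2 d, D d & exists2 d', D' d' & v = d + d'];
  base_scale : forall (r : R) D, 0 < r -> B D -> B ( *:%R r @` D);
  base_banach : forall D, B D -> banach_disk D }.

Definition base_equiv (B B' : set (set V)) :=
  (forall D, B D -> exists2 D', B' D' & D `<=` D') /\
  (forall D, B' D -> exists2 D', B D' & D `<=` D').

Definition base_class (B : set (set V)) : set (set (set V)) :=
  [set B' | is_base B' /\ base_equiv B B'].

End Disks.

(* The bornology is the equivalence class of bases itself. *)
Record cborn := CBornSpace {
  cborn_space :> lmodType R;
  bases : set (set (set cborn_space));
  basesP : exists2 B, is_base B & bases = base_class B }.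
Arguments bases : clear implicits.

Definition cborn_of_base (V : lmodType R) (B : set (set V)) (hB : is_base B) :=
  CBornSpace (ex_intro2 _ _ B hB erefl).

Definition bounded (E : cborn) (A : set E) :=
  exists2 B, bases E B & exists2 D, B D & A `<=` D.

Record cborn_hom (E F : cborn) := CBornHom {
  cborn_fun :> E -> F;
  cborn_linear : linear cborn_fun;
  cborn_bounded : forall A : set E, bounded A -> bounded (cborn_fun @` A) }.

Lemma cborn_hom_eq (E F : cborn) (f g : cborn_hom E F) : f =1 g -> f = g.
Proof.
case: f g => [f lf bf] [g lg bg] /= /funext fg; subst g.
by congr CBornHom; exact: Prop_irrelevance.
Qed.

Program Definition cborn_id (E : cborn) : cborn_hom E E :=
  @CBornHom E E (fun x => x) _ _.
Next Obligation. by []. Qed.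
Next Obligation. by move=> E A; rewrite image_id. Qed.

Program Definition cborn_comp (E F G : cborn) (g : cborn_hom F G)
    (f : cborn_hom E F) : cborn_hom E G :=
  @CBornHom E G (fun x => g (f x)) _ _.
Next Obligation.
by move=> E F G g f a u v; rewrite !cborn_linear.
Qed.
Next Obligation.
move=> E F G g f A bA; rewrite -(image_comp f g).
exact/cborn_bounded/cborn_bounded.
Qed.

Program Definition CBorn : category :=
  Category (@CategoryOn cborn cborn_hom cborn_id cborn_comp _ _ _).
Next Obligation. by move=> *; exact: cborn_hom_eq. Qed.
Next Obligation. by move=> *; exact: cborn_hom_eq. Qed.
Next Obligation. by move=> *; exact: cborn_hom_eq. Qed.

Lemma base_equiv_refl (V : lmodType R) (B : set (set V)) : base_equiv B B.
Proof. by split=> D BD; exists D. Qed.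

Lemma bounded1 (E : cborn) (x : E) : bounded [set x].
Proof.
have [B hB EB] := basesP E; have [D BD Dx] := base_cover hB x.
exists B; last by exists D => // _ ->.
by rewrite EB; split=> //; exact: base_equiv_refl.
Qed.

Program Definition cborn_zero (E F : cborn) : cborn_hom E F :=
  @CBornHom E F (fun=> 0) _ _.
Next Obligation. by move=> E F a u v; rewrite scaler0 addr0. Qed.
Next Obligation.
move=> E F A _; have [B EB [D BD D0]] := bounded1 (0 : F).
by exists B => //; exists D => // _ [? _ <-]; exact: D0.
Qed.

Definition is_cokernel (E F G : CBorn) (g : hom E F) (f : hom F G) :=
  comp f g = cborn_zero E G /\
  forall (H : CBorn) (h : hom F H), comp h g = cborn_zero E H ->
    exists! k : hom G H, comp k f = h.

Definition strict_epi (F G : CBorn) (f : hom F G) :=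
  exists (E : CBorn) (g : hom E F), is_cokernel g f.

Section Banach.
Variable V : completeNormedModType R.

Definition ball_base : set (set V) := [set ball (0 : V) r | r in [set r | 0 < r]].

Lemma ball0E (r : R) (v : V) : ball (0 : V) r v = (`|v| < r).
Proof. by rewrite -ball_normE /= sub0r normrN. Qed.

Lemma ball_span (r : R) (v : V) : 0 < r -> disk_span (ball (0 : V) r) v.
Proof.
move=> r0; have n1 : 0 < `|v| + 1 by rewrite ltr_wpDl.
have t0 : 0 < (`|v| + 1) / r by rewrite divr_gt0.
exists ((`|v| + 1) / r), (((`|v| + 1) / r)^-1 *: v).
  rewrite ball0E normrZ gtr0_norm ?invr_gt0// mulrC ltr_pdivrMr//.
  by rewrite mulrC divfK ?gt_eqF// ltrDl.
by rewrite scalerA divff ?scale1r// gt_eqF.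
Qed.

Lemma gauge_ball (r : R) (v : V) : 0 < r -> gauge (ball (0 : V) r) v = `|v| / r.
Proof.
move=> r0; rewrite /gauge.
set A := (X in inf X).
have AE : A = [set s | `|v| / r < s].
  apply/seteqP; split=> s /=.
    move=> [s0 [d]]; rewrite ball0E => dr ->.
    by rewrite normrZ gtr0_norm// ltr_pdivrMr// ltr_pM2l.
  move=> vs; have s0 : 0 < s by rewrite (le_lt_trans _ vs)// divr_ge0// ltW.
  split=> //; exists (s^-1 *: v); last by rewrite scalerA divff ?gt_eqF ?scale1r.
  rewrite ball0E normrZ gtr0_norm ?invr_gt0// mulrC ltr_pdivrMr//.
  by rewrite mulrC -ltr_pdivrMr.
rewrite AE.
have -> : [set s | `|v| / r < s] = [set` `](`|v| / r), +oo[ ].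
  by apply/seteqP; split=> s /=; rewrite in_itv/= andbT.
by rewrite inf_itv.
Qed.

Lemma ball_base_is_base : is_base ball_base.
Proof.
split.
- move=> _ [r /= r0 <-]; split.
    move=> x y l; rewrite !inE ![ball _ _ _]ball0E => xr yr.
    have [->|l0] := eqVneq l 0%:i01; first by rewrite conv0.
    have [->|l1] := eqVneq l 1%:i01; first by rewrite conv1.
    have l_gt0 : 0 < l%:num by rewrite lt_neqAle eq_sym l0 ge0.
    have l_lt1 : l%:num < 1 by rewrite lt_neqAle l1 le1.
    rewrite (le_lt_trans (ler_normD _ _))// !normrZ.
    rewrite (@ger0_norm _ l%:num)// (@ger0_norm _ l%:num.~) ?onem_ge0//.
    rewrite -[ltRHS]mul1r -(add_onemK l%:num) [ltRHS]mulrDl.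
    by rewrite ltrD// ltr_pM2l// onem_gt0.
  move=> t; rewrite -ler_norml => t1 v; rewrite !ball0E => vr.
  by rewrite normrZ (le_lt_trans _ vr)// ler_piMl.
- move=> v; exists (ball (0 : V) (`|v| + 1)); last by rewrite ball0E ltrDl.
  by exists (`|v| + 1) => //=; rewrite ltr_wpDl.
- move=> _ _ [r /= r0 <-] [s /= s0 <-]; exists (r + s); first exact: addr_gt0.
  have rs0 : 0 < r + s by exact: addr_gt0.
  apply/seteqP; split=> v /=; rewrite ball0E.
    move=> vrs; have vrs1 : `|v| / (r + s) < 1 by rewrite ltr_pdivrMr// mul1r.
    have scl t : 0 < t -> ball (0 : V) t ((t / (r + s)) *: v).
      move=> t0; rewrite ball0E normrZ gtr0_norm ?divr_gt0//.
      by rewrite mulrAC -mulrA gtr_pMr.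
    exists ((r / (r + s)) *: v); first exact: scl.
    exists ((s / (r + s)) *: v); first exact: scl.
    by rewrite -scalerDl -mulrDl divff ?scale1r ?gt_eqF.
  move=> [d + [d' + ->]]; rewrite !ball0E => dr d's.
  by rewrite (le_lt_trans (ler_normD _ _))// ltrD.
- move=> r _ r0 [s /= s0 <-]; exists (r * s); first exact: mulr_gt0.
  apply/seteqP; split=> v /=; rewrite ball0E.
    move=> vrs; exists (r^-1 *: v); last by rewrite scalerA divff ?scale1r ?gt_eqF.
    rewrite ball0E normrZ gtr0_norm ?invr_gt0// mulrC ltr_pdivrMr//.
    by rewrite mulrC.
  move=> [d + <-]; rewrite ball0E => ds.
  by rewrite normrZ gtr0_norm// ltr_pM2l.
- move=> _ [r /= r0 <-]; split; first exact: ball_span.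
    move=> v _; rewrite gauge_ball// => /eqP; rewrite mulf_eq0 invr_eq0.
    by rewrite (gt_eqF r0) orbF normr_eq0 => /eqP.
  move=> x _ cx.
  have /cvg_ex[l xl] : cvg (x @ \oo).
    apply: cauchy_cvg; apply/cauchy_ballP => e e0.
    have [N xN] := cx (e / r) (divr_gt0 e0 r0).
    pose A : set V := x @` [set n | (N <= n)%N].
    have FA : (x @ \oo) A by exists N => // n Nn; exists n.
    exists (A, A) => // -[_ _] /= [[m Nm <-] [n Nn <-]]; rewrite -ball_normE /=.
    by have := xN m n Nm Nn; rewrite gauge_ball// ltr_pM2r ?invr_gt0.
  exists l; first exact: ball_span.
  move=> e e0; have er0 : 0 < e * r by exact: mulr_gt0.
  have /cvgrPdist_lt/(_ _ er0)[N _ xN] := xl.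
  exists N => n Nn; rewrite gauge_ball// ltr_pdivrMr// distrC.
  exact: xN.
Qed.

Definition cborn_of_banach : cborn := cborn_of_base ball_base_is_base.

End Banach.

Section L1.
Variable S : smallType.

(* The library's unordered sums range over a choiceType, whence {classic S}. *)
Definition l1_mem : {pred {classic S} -> R^o} :=
  [pred f | summable [set: {classic S}] (EFin \o f)].

Lemma l1_sum_bound (f : {classic S} -> R^o) (M : R) :
  (forall X : set {classic S}, finite_set X ->
    \sum_(s <- fset_set X) `|f s| <= M) ->
  (\esum_(s in [set: {classic S}]) `|(f s)%:E| <= M%:E)%E.
Proof.
move=> fM; apply: ge_ereal_sup => _ [X [fX _] <-].
by rewrite fsbig_finite//= sumEFin lee_fin fM.
Qed.

Lemma l1_mem_bound (f : {classic S} -> R^o) (M : R) :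
  (forall X : set {classic S}, finite_set X ->
    \sum_(s <- fset_set X) `|f s| <= M) -> f \in l1_mem.
Proof.
by move=> /l1_sum_bound fM; rewrite inE /summable (le_lt_trans fM)// ltry.
Qed.

Lemma l1_mem_ge (f : {classic S} -> R^o) (X : set {classic S}) :
  f \in l1_mem -> finite_set X ->
  \sum_(s <- fset_set X) `|f s| <=
    fine (\esum_(s in [set: {classic S}]) `|(f s)%:E|%E).
Proof.
rewrite inE summableE => f1 fX; rewrite -lee_fin fineK//.
by apply: esum_ge; exists X; [split|rewrite fsbig_finite//= sumEFin].
Qed.

Lemma l1_submod_closed : submod_closed l1_mem.
Proof.
split=> [|a f g f1 g1].
  by rewrite inE /summable esum1// => s _; rewrite /= normr0.
pose N (h : {classic S} -> R^o) :=
  fine (\esum_(s in [set: {classic S}]) `|(h s)%:E|%E).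
apply: (@l1_mem_bound _ (`|a| * N f + N g)) => X fX.
apply: (@le_trans _ _ (`|a| * (\sum_(s <- fset_set X) `|f s|) +
                       \sum_(s <- fset_set X) `|g s|)).
  rewrite mulr_sumr -big_split/=; apply: ler_sum => s _.
  by rewrite (le_trans (ler_normD _ _))// normrM.
by rewrite lerD ?ler_wpM2l ?l1_mem_ge.
Qed.

HB.instance Definition _ :=
  GRing.isSubmodClosed.Build R ({classic S} -> R^o) l1_mem l1_submod_closed.

Record l1 := L1 { l1_fun :> {classic S} -> R^o; _ : l1_fun \in l1_mem }.

HB.instance Definition _ := [isSub for l1_fun].
HB.instance Definition _ := [Choice of l1 by <:].
HB.instance Definition _ := [SubChoice_isSubLmodule of l1 by <:].

Definition l1_norm (f : l1) : R :=
  fine (\esum_(s in [set: {classic S}]) `|(f s)%:E|%E).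

Lemma l1_norm_ge (f : l1) (X : set {classic S}) : finite_set X ->
  \sum_(s <- fset_set X) `|f s| <= l1_norm f.
Proof. by apply: l1_mem_ge; case: f. Qed.

Lemma l1_norm_le (f : l1) (M : R) :
  (forall X : set {classic S}, finite_set X ->
    \sum_(s <- fset_set X) `|f s| <= M) -> l1_norm f <= M.
Proof.
move=> /l1_sum_bound fM; rewrite -lee_fin fineK//.
by rewrite -summableE; have := valP f; rewrite inE.
Qed.

Lemma l1_ev_le (f : l1) (s : {classic S}) : `|f s| <= l1_norm f.
Proof.
have := @l1_norm_ge f [set s] (finite_set1 s).
by rewrite fset_set1 big_seq_fset1.
Qed.

Lemma l1_normD (f g : l1) : l1_norm (f + g) <= l1_norm f + l1_norm g.
Proof.
apply: l1_norm_le => X fX.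
apply: (@le_trans _ _ (\sum_(s <- fset_set X) `|f s| +
                       \sum_(s <- fset_set X) `|g s|)).
  by rewrite -big_split/=; apply: ler_sum => s _; exact: ler_normD.
by rewrite lerD ?l1_norm_ge.
Qed.

Lemma l1_normZ_le (a : R) (f : l1) : l1_norm (a *: f) <= `|a| * l1_norm f.
Proof.
apply: l1_norm_le => X fX.
under eq_bigr do rewrite [X in `|X|]/(a * f _) normrM.
by rewrite -mulr_sumr ler_wpM2l ?l1_norm_ge.
Qed.

Lemma l1_norm0_eq0 (f : l1) : l1_norm f = 0 -> f = 0.
Proof.
move=> f0; apply/val_inj/funext => s /=; apply/eqP.
by rewrite -normr_le0 -f0 l1_ev_le.
Qed.

Lemma l1_normZ (a : R) (f : l1) : l1_norm (a *: f) = `|a| * l1_norm f.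
Proof.
apply/le_anti; rewrite l1_normZ_le /=.
have [->|a0] := eqVneq a 0.
  by rewrite normr0 mul0r (le_trans _ (l1_norm_ge _ (finite_set0 _)))// sumr_ge0.
rewrite -ler_pdivlMl ?normr_gt0// -normfV.
by rewrite (le_trans _ (l1_normZ_le _ _))// scalerA mulVf// scale1r.
Qed.

HB.instance Definition _ :=
  Lmodule_isNormed.Build R l1 l1_normD l1_normZ l1_norm0_eq0.

Lemma l1_normE (f : l1) : `|f| = l1_norm f. Proof. by []. Qed.

Lemma l1_complete (F : set_system l1) : ProperFilter F -> cauchy F -> cvg F.
Proof.
move=> FF Fc.
have cvs (s : {classic S}) : cvg ((fun h : l1 => (h s : R)) @ F).
  apply: cauchy_cvg; apply/cauchy_exP => e e0.
  have /cauchyP /(_ e e0)[x Fx] := Fc.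
  exists (x s); rewrite /nbhs/=.
  suff: F [set h : l1 | ball (x s : R) e (h s : R)] by [].
  apply: (filterS _ Fx) => h; rewrite -!ball_normE /=.
  by apply: le_lt_trans; exact: (l1_ev_le (x - h) s).
pose g (s : {classic S}) : R^o := lim ((fun h : l1 => (h s : R)) @ F).
have gx (x : l1) (e : R) : F (ball x e) ->
    forall X : set {classic S}, finite_set X ->
    \sum_(s <- fset_set X) `|x s - g s| <= e.
  move=> Fx X fX.
  have cg : (fun h : l1 => \sum_(s <- fset_set X) `|x s - h s|) @ F
      --> \sum_(s <- fset_set X) `|x s - g s|.
    elim: (fset_set X : seq _) => [|s r IH].
      under eq_fun do rewrite big_nil.
      by rewrite big_nil; exact: cvg_cst.
    under eq_fun do rewrite big_cons.
    rewrite big_cons; apply: cvgD => //; apply: cvg_norm; apply: cvgB.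
      exact: cvg_cst.
    exact: cvs.
  rewrite -(cvg_lim (@Rhausdorff R) cg); apply: limr_le; first by apply/cvg_ex; eexists; exact: cg.
  apply: filterS Fx => h; rewrite -ball_normE /= => /ltW; apply: le_trans.
  exact: (l1_norm_ge (x - h)).
have /cauchyP Fe := Fc.
have g1 : g \in l1_mem.
  have [x Fx] := Fe 1 ltr01.
  have xg1 : (x : {classic S} -> R^o) - g \in l1_mem.
    exact: l1_mem_bound (gx x 1 Fx).
  have -> : g = (x : {classic S} -> R^o) - ((x : {classic S} -> R^o) - g).
    by rewrite opprB addrCA subrr addr0.
  by rewrite rpredB//; exact: valP.
apply/cvg_ex; exists (L1 g1); apply/cvgrPdist_le => e e0.
have e2 : 0 < e / 2 by rewrite divr_gt0.
have [x Fx] := Fe _ e2.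
apply: filterS (Fx) => h; rewrite -ball_normE /= => xh.
rewrite -(subrKA x) (le_trans (ler_normD _ _))//.
rewrite [leRHS]splitr lerD//; last exact: ltW.
rewrite distrC l1_normE; apply: l1_norm_le => X fX; exact: gx.
Qed.

HB.instance Definition _ := Uniform_isComplete.Build l1 l1_complete.

End L1.

Definition CBorn_l1 (S : smallType) : CBorn := cborn_of_banach (l1 S).

Definition CBorn_lt (K : smallType) : category :=
  @full_subcategory CBorn (fun B : CBorn =>
    exists (I : smallType) (S : I -> smallType),
      (forall i, card_lt [set: S i] [set: K]) /\
      exists (P : CBorn) (inj : forall i, hom (CBorn_l1 (S i)) P)
        (f : hom P B), is_coproduct inj /\ strict_epi f).

End Bornology.
Arguments bases {R} c _.

(* Main.v *)
(* An object of CBorn^{<K} is a quotient, by a closed subspace, of a space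
   [l1sum pi] of summable families supported in finitely many fibres of
   [pi : T -> I], where all fibres have fewer than K elements; a morphism out of
   [l1sum pi] is a family of vectors indexed by [T] that is bounded on each fibre.

   Colimits: take the [l1sum] of the generators of all the objects of the diagram
   and divide by the vectors that every cocone kills.

   In a K-directed colimit every bounded set comes from a bounded set of some
   stage, and a vector that dies in the colimit dies at some stage.  The second
   point holds because the vectors that die at some stage form a closed subspace:
   if K > aleph_0, bound the stages at which the terms of a convergent sequence
   die; if K = aleph_0, all fibres are finite, so that the sequence stays in a
   finite-dimensional space.  Hence a quotient of [l1sum pi] with fewer than K
   generators and fewer than K relations is K-presentable.

   Finally, a quotient B of [l1sum pi] by W is the K-directed colimit, over the
   pairs (A, N) of subsets of [T] and W with fewer than K elements, of the
   quotients of [l1sum (pi restricted to A)] by the relations N. *)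

Require Import Defs.
From HB Require Import structures.
From mathcomp Require Import all_boot all_order all_algebra.
From mathcomp Require Import finmap unstable all_classical all_reals all_analysis.
From mathcomp Require Import lra.
Import Defs.

Set Implicit Arguments.
Unset Strict Implicit.
Unset Printing Implicit Defensive.

Import Order.TTheory GRing.Theory Num.Theory.
Import numFieldNormedType.Exports.

Local Open Scope classical_set_scope.
Local Open Scope card_scope.
Local Open Scope ring_scope.

(** * Complete disks *)

(** Separation is the obstacle. In vector spaces a directed colimit divides exactly by the vectors
    that die at some stage; here only a subspace closed under limits in every bounded complete disk
    can be divided out, and a larger closed subspace would put into the kernel vectors that die
    nowhere. Closedness becomes accessible because all but finitely many terms of a convergent
    sequence lie in one bounded set, which meets only finitely many fibres.

    The size of the fibres serves once more when an object is recovered from small pieces: a whole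
    fibre fits into one piece, so maps that are compatible on the pieces glue to a family bounded on
    each fibre.

    Two choices of form keep the analysis elementary. Convergence is expressed by membership in
    dilates of a disk, and the gauge appears only in the passage to and from Banach disks. *)

Lemma half_gt0 (R : realType) (e : R) : 0 < e -> 0 < e / 2.
Proof. by move=> e0; rewrite divr_gt0. Qed.

Lemma exp2V_gt0 (R : realType) k : 0 < (2 : R) ^- k.
Proof. by rewrite invr_gt0 exprn_gt0. Qed.

Lemma exp2V_small (R : realType) (e : R) : 0 < e ->
  exists k0 : nat, forall k : nat, (k0 <= k)%N -> 2 ^- k <= e.
Proof.
move=> e0; exists (Num.truncn e^-1).+1 => k k0k.
rewrite invf_ple ?posrE ?exprn_gt0//.
apply: (le_trans (ltW (truncnS_gt _))).
by rewrite -natrX ler_nat (leq_trans k0k)// ltnW// ltn_expl.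
Qed.

Section AbsolutelyConvex.
Local Open Scope convex_scope.
Variables (R : realType) (V : lmodType R).
Implicit Types (D : set V) (v w l : V) (x : nat -> V) (e : R).

Definition adisk D :=
  D 0 /\ forall (a b : R) v w, `|a| + `|b| <= 1 -> D v -> D w ->
    D (a *: v + b *: w).

(** The signs of [a] and [b] are absorbed into the vectors; what remains is [|a| + |b|] times a
    convex combination. *)
Lemma disk_adisk D : disk D -> D !=set0 -> adisk D.
Proof.
move=> [cD bD] [v0 Dv0].
have D0 : D 0.
  by rewrite -(scale0r v0); apply: bD => //; rewrite ler01 andbT lerN10.
split=> // a b v w ab Dv Dw.
have [s0|s0] := eqVneq (`|a| + `|b|) 0.
  have a0 : a = 0 by apply/eqP; rewrite -normr_le0 -s0 lerDl.
  have b0 : b = 0 by apply/eqP; rewrite -normr_le0 -s0 lerDr.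
  by rewrite a0 b0 !scale0r addr0.
pose s := `|a| + `|b|.
have sp : 0 < s by rewrite lt_neqAle eq_sym s0 /= addr_ge0.
have sgD c u : D u -> D (Num.sg c *: u).
  by move=> Du; apply: bD => //; case: sgrP => _; rewrite ?lexx; lra.
have l0 : (0 <= `|a| / s) by rewrite divr_ge0// ltW.
have l1 : (`|a| / s <= 1) by rewrite ler_pdivrMr// mul1r lerDl.
have l01 : Itv.spec (@Itv.num_sem R) (Itv.Real `[0, 1]%Z) (`|a| / s).
  by rewrite /= /Itv.num_sem/= realE l0 /= in_itv/= l0 l1.
have /(_ (Num.sg a *: v) (Num.sg b *: w) (Itv.Def l01)) := cD.
rewrite !inE => /(_ (sgD a _ Dv) (sgD b _ Dw)) Dab.
suff -> : a *: v + b *: w = s *: ((Num.sg a *: v : convex_lmodType V)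
    <| Itv.Def l01 |> (Num.sg b *: w : convex_lmodType V)).
  by apply: bD => //; rewrite ab andbT; lra.
rewrite /conv/= scalerDr !scalerA /onem.
rewrite !mulrA.
have -> : s * (1 - `|a| / s) = `|b|.
  by rewrite mulrBr mulr1 mulrCA divff// mulr1 /s; lra.
by rewrite [s * _]mulrC mulfK// ![ `|_| * _]mulrC -!numEsg.
Qed.

Lemma adisk_disk D : adisk D -> disk D.
Proof.
move=> [D0 cD]; split.
  move=> v w l; rewrite !inE => Dv Dw; apply: cD => //.
  by rewrite !ger0_norm ?onem_ge0//= /onem; lra.
move=> t t1 v Dv; have := cD t 0 v 0; rewrite scale0r addr0; apply=> //.
by rewrite normr0 addr0 ler_norml.
Qed.

(* Membership of [v] in [e D], meaningful for [e > 0] only. *)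
Definition dil D e v := D (e^-1 *: v).

(** Only the differences have to lie in the span of [D]; the terms and the limit may lie outside
    it. *)
Definition mcvg D x l :=
  forall e, 0 < e -> exists N : nat, forall n, (N <= n)%N -> dil D e (x n - l).

Definition mcauchy D x := forall e, 0 < e -> exists N : nat,
  forall m n, (N <= m)%N -> (N <= n)%N -> dil D e (x m - x n).

Definition separated D := forall v, (forall e, 0 < e -> dil D e v) -> v = 0.

Definition complete_disk D :=
  separated D /\ forall x, mcauchy D x -> exists l, mcvg D x l.

Section Dilations.
Variable D : set V.
Hypothesis hD : adisk D.

Lemma dilZ (a : R) e e' v : 0 < e -> 0 < e' -> `|a| * e <= e' -> dil D e v ->
  dil D e' (a *: v).
Proof.
move=> e0 e'0 ae Dv; rewrite /dil.
have -> : e'^-1 *: (a *: v) = (e'^-1 * a * e) *: (e^-1 *: v) + 0 *: 0.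
  by rewrite !scalerA scaler0 addr0; rewrite mulfK// gt_eqF.
apply: hD.2 => //; last exact: hD.1.
rewrite normr0 addr0 !normrM (gtr0_norm e0) gtr0_norm ?invr_gt0//.
by rewrite -mulrA mulrC ler_pdivrMr// mul1r.
Qed.

Lemma dil_le e e' v : 0 < e -> e <= e' -> dil D e v -> dil D e' v.
Proof.
move=> e0 ee' Dv; rewrite -(scale1r v); apply: dilZ Dv => //.
  exact: lt_le_trans ee'.
by rewrite normr1 mul1r.
Qed.

Lemma dilD e e' v w : 0 < e -> 0 < e' -> dil D e v -> dil D e' w ->
  dil D (e + e') (v + w).
Proof.
move=> e0 e'0 Dv Dw; rewrite /dil.
have ee : 0 < e + e' by exact: addr_gt0.
have -> : (e + e')^-1 *: (v + w) =
    (e / (e + e')) *: (e^-1 *: v) + (e' / (e + e')) *: (e'^-1 *: w).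
  by rewrite !scalerA scalerDr (mulrAC e) (mulrAC e') !divff ?mul1r ?gt_eqF.
apply: hD.2 => //.
rewrite !gtr0_norm ?divr_gt0// -mulrDl divff// gt_eqF//.
Qed.

Lemma dilN e v : 0 < e -> dil D e v -> dil D e (- v).
Proof.
by move=> e0 Dv; rewrite -scaleN1r; apply: dilZ Dv => //; rewrite normrN1 mul1r.
Qed.

Lemma dilB e e' v w : 0 < e -> 0 < e' -> dil D e v -> dil D e' w ->
  dil D (e + e') (v - w).
Proof. by move=> e0 e'0 Dv Dw; apply: dilD => //; exact: dilN. Qed.

Lemma dil0 e : dil D e 0. Proof. by rewrite /dil scaler0; exact: hD.1. Qed.

Lemma dil_half e v w : 0 < e -> dil D (e / 2) v -> dil D (e / 2) w ->
  dil D e (v + w).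
Proof. by move=> e0 Dv Dw; rewrite [e]splitr; apply: dilD => //; rewrite divr_gt0. Qed.

Lemma mcvg_sub x l m l' : mcvg D x l -> mcvg D m l' ->
  mcvg D (fun n => x n - m n) (l - l').
Proof.
move=> xl ml e e0; have e2 : 0 < e / 2 by rewrite divr_gt0.
have [N1 h1] := xl _ e2; have [N2 h2] := ml _ e2.
exists (maxn N1 N2) => n; rewrite geq_max => /andP[n1 n2].
have -> : x n - m n - (l - l') = (x n - l) - (m n - l').
  by rewrite !opprB addrACA [in RHS]addrACA; congr (_ + _); rewrite addrC.
by apply: dil_half => //; [exact: h1|apply: dilN => //; exact: h2].
Qed.

Lemma mcvg_uniq x l l' : separated D -> mcvg D x l -> mcvg D x l' -> l = l'.
Proof.
move=> sD xl xl'; apply/eqP; rewrite -subr_eq0; apply/eqP/sD => e e0.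
have [N h] := mcvg_sub xl xl' e0.
by have := h N (leqnn _); rewrite subrr sub0r => /(dilN e0); rewrite opprK.
Qed.

Lemma dil_span e v : 0 < e -> dil D e v -> disk_span D v.
Proof.
move=> e0 Dv; exists e, (e^-1 *: v) => //.
by rewrite scalerA divff ?scale1r// gt_eqF.
Qed.

Lemma span_dil v : disk_span D v -> exists2 e, 0 < e & dil D e v.
Proof.
move=> [t [d Dd ->]]; exists (`|t| + 1); first by rewrite ltr_wpDl.
apply: (@dilZ _ 1); rewrite ?ltr_wpDl ?mulr1 ?lerDl//.
by rewrite /dil invr1 scale1r.
Qed.

Lemma spanD v w : disk_span D v -> disk_span D w -> disk_span D (v + w).
Proof.
move=> /span_dil[e e0 Dv] /span_dil[f f0 Dw].
by apply: (@dil_span (e + f)); [exact: addr_gt0|exact: dilD].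
Qed.

Lemma spanN v : disk_span D v -> disk_span D (- v).
Proof. by move=> /span_dil[e e0 Dv]; apply: (dil_span e0); exact: dilN. Qed.

Lemma gauge_set_nonempty v : disk_span D v ->
  [set r : R | 0 < r /\ exists2 d, D d & v = r *: d] !=set0.
Proof.
move=> /span_dil[e e0 Dv]; exists e; split => //; exists (e^-1 *: v) => //.
by rewrite scalerA divff ?scale1r// gt_eqF.
Qed.

Lemma gauge_lt_dil e v : disk_span D v -> gauge D v < e -> dil D e v.
Proof.
move=> sv /(inf_lt (gauge_set_nonempty sv))[r [r0 [d Dd ->]] re].
apply: (dil_le r0 (ltW re)).
by rewrite /dil scalerA mulVf ?scale1r// gt_eqF.
Qed.

Lemma dil_gauge_le e v : 0 < e -> dil D e v -> gauge D v <= e.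
Proof.
move=> e0 Dv; apply: ge_inf; first by exists 0 => r [/ltW].
split=> //; exists (e^-1 *: v) => //.
by rewrite scalerA divff ?scale1r// gt_eqF.
Qed.

Lemma dil_gauge_lt e v : 0 < e -> dil D (e / 2) v -> gauge D v < e.
Proof.
move=> e0 /dil_gauge_le; rewrite divr_gt0// => /(_ isT)/le_lt_trans; apply.
by rewrite ltr_pdivrMr// ltr_pMr// ltr1n.
Qed.

(** The Banach property speaks of sequences in the span, [complete_disk] of arbitrary ones:
    subtracting a late term moves a Cauchy sequence into the span. *)
Lemma banach_complete : banach_disk D -> complete_disk D.
Proof.
move=> [_ sD cD]; split.
  move=> v hv; have sv : disk_span D v by apply: (dil_span ltr01); exact: hv.
  apply: sD => //; apply/le_anti/andP; split.
    by apply/ler_gtP => e e0; apply: dil_gauge_le => //; exact: hv.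
  by apply: lb_le_inf; [exact: gauge_set_nonempty|move=> r [/ltW]].
move=> x cx; have [N0 h0] := cx 1 ltr01.
have ss n : disk_span D (x (n + N0)%N - x N0).
  by apply: (dil_span ltr01); apply: h0 => //; rewrite leq_addl.
have [|l sl hl] := cD _ ss.
  move=> e e0; have [N h] := cx (e / 2) (half_gt0 e0).
  exists N => m n Nm Nn; rewrite opprB subrKA.
  by apply: dil_gauge_lt => //; apply: h; exact: leq_trans (leq_addr _ _).
exists (l + x N0) => e e0; have [N h] := hl e e0.
exists (N + N0)%N => n Nn; have N0n : (N0 <= n)%N by exact: leq_trans (leq_addl _ _) Nn.
have Nn' : (N <= n - N0)%N by rewrite leq_subRL// addnC.
have := h _ Nn'; rewrite subnK// [l + _]addrC opprD addrA => hg.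
apply: gauge_lt_dil => //; apply: spanD; last exact: spanN.
by have := ss (n - N0)%N; rewrite subnK.
Qed.

Lemma complete_banach : complete_disk D -> banach_disk D.
Proof.
move=> [sD cD]; split.
- by exists 0, 0; [exact: hD.1|rewrite scale0r].
- move=> v sv v0; apply: sD => e e0; apply: gauge_lt_dil => //.
  by rewrite v0.
move=> x sx cx; have [|l hl] := cD x.
  move=> e e0; have [N h] := cx _ e0; exists N => m n Nm Nn.
  by apply: gauge_lt_dil; [apply: spanD => //; exact: spanN|exact: h].
exists l.
  have [N h] := hl 1 ltr01.
  rewrite -(subKr (x N) l); apply: spanD => //; apply: spanN => //.
  exact: (dil_span ltr01 (h N (leqnn _))).
move=> e e0; have [N h] := hl (e / 2) (half_gt0 e0).
by exists N => n Nn; apply: dil_gauge_lt => //; exact: h.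
Qed.

Lemma fast_tail x (k j : nat) : (forall k, dil D (2 ^- k) (x k.+1 - x k)) ->
  dil D (2 * 2 ^- k) (x (k + j)%N - x k).
Proof.
move=> fx; elim: j k => [|j IH] k; first by rewrite addn0 subrr; exact: dil0.
rewrite addnS -addSn -(subrKA (x k.+1)).
have -> : 2 * 2 ^- k = 2 * 2 ^- k.+1 + 2 ^- k :> R.
  by rewrite exprS invfM mulrA divff ?pnatr_eq0// mul1r; lra.
by apply: dilD => //; rewrite ?exp2V_gt0// mulr_gt0// exp2V_gt0.
Qed.

Lemma fast_mcauchy x : (forall k, dil D (2 ^- k) (x k.+1 - x k)) -> mcauchy D x.
Proof.
move=> fx e e0; have [k hk] := exp2V_small (half_gt0 (half_gt0 e0)).
have h n : (k <= n)%N -> dil D (e / 2) (x n - x k).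
  move=> /subnKC <-; apply: dil_le (fast_tail _ _ fx).
    by rewrite mulr_gt0// exp2V_gt0.
  by have := hk k (leqnn _); lra.
exists k => m n km kn; rewrite -(subrKA (x k)); apply: dil_half => //.
  exact: h.
by rewrite -opprB; apply: dilN; [exact: half_gt0|exact: h].
Qed.

(** A Cauchy sequence converges as soon as a subsequence does, and a subsequence can be chosen with
    its steps in [2^-k D]. *)
Lemma fast_complete : separated D ->
  (forall x, (forall k, dil D (2 ^- k) (x k.+1 - x k)) -> exists l, mcvg D x l) ->
  complete_disk D.
Proof.
move=> sD fD; split=> // x cx.
have /choice[N hN] k := cx _ (exp2V_gt0 R k).
(* Partial sums make the indices monotone while [n k] stays at least [N k]. *)
pose n k := (\sum_(i < k.+1) N i)%N.
have Nn k : (N k <= n k)%N by rewrite /n big_ord_recr/= leq_addl.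
have nS k : (n k <= n k.+1)%N by rewrite {2}/n big_ord_recr/= leq_addr.
have [|l hl] := fD (x \o n).
  by move=> k; apply: hN => //; exact: leq_trans (nS k).
exists l => e e0; have [k1 h1] := hl _ (half_gt0 e0).
have [k2 h2] := exp2V_small (half_gt0 e0).
pose k := maxn k1 k2; exists (n k) => m nm.
rewrite -(subrKA (x (n k))); apply: dil_half => //; last first.
  by apply: h1; rewrite leq_maxl.
apply: (dil_le (exp2V_gt0 R k)); first by apply: h2; rewrite leq_maxr.
by apply: hN => //; exact: leq_trans nm.
Qed.

End Dilations.

(** Each disk lies in a multiple of the other, so the gauges are equivalent and the same sequences
    are Cauchy or convergent. *)
Lemma complete_sandwich D D' (a b : R) : adisk D -> adisk D' ->
  0 < a -> 0 < b -> (forall v, D v -> dil D' a v) ->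
  (forall v, D' v -> dil D b v) -> complete_disk D -> complete_disk D'.
Proof.
move=> hD hD' a0 b0 DD' D'D [sD cD].
have to e v : 0 < e -> dil D (e / a) v -> dil D' e v.
  move=> e0 /DD'; rewrite /dil scalerA invf_div.
  by rewrite mulrA mulVf ?mul1r// gt_eqF.
have fro e v : 0 < e -> dil D' (e / b) v -> dil D e v.
  move=> e0 /D'D; rewrite /dil scalerA invf_div.
  by rewrite mulrA mulVf ?mul1r// gt_eqF.
split.
  by move=> v hv; apply: sD => e e0; apply: fro => //; apply: hv; rewrite divr_gt0.
move=> x cx; have [|l hl] := cD x.
  move=> e e0; have [N h] := cx _ (divr_gt0 e0 b0).
  by exists N => m n Nm Nn; apply: fro => //; exact: h.
exists l => e e0; have [N h] := hl _ (divr_gt0 e0 a0).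
by exists N => n Nn; apply: to => //; exact: h.
Qed.

End AbsolutelyConvex.

Section LinearImage.
Variables (R : realType) (V V' : lmodType R) (f : {linear V -> V'}).
Variable D : set V.
Hypothesis hD : adisk D.

Lemma adisk_image : adisk (f @` D).
Proof.
split; first by exists 0; [exact: hD.1|rewrite linear0].
move=> a b _ _ ab [v Dv <-] [w Dw <-]; exists (a *: v + b *: w).
  exact: hD.2.
by rewrite linearD !linearZ.
Qed.

Lemma dil_imageP e v' : 0 < e ->
  dil (f @` D) e v' <-> exists2 v, dil D e v & f v = v'.
Proof.
move=> e0; split=> [[v Dv fv]|[v Dv <-]].
  exists (e *: v); first by rewrite /dil scalerA mulVf ?scale1r// gt_eqF.
  by rewrite linearZ fv /= scalerA divff ?scale1r// gt_eqF.
by exists (e^-1 *: v) => //; rewrite linearZ.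
Qed.

(** The steps of a fast Cauchy sequence lift to [D], and the sum of the lifts gives the limit, as
    for the quotient of a Banach space by a closed subspace; the second hypothesis says that the
    kernel of [f] is closed in this sense. *)
Lemma complete_image : complete_disk D ->
  (forall x l, (forall n, f (x n) = 0) -> mcvg D x l -> f l = 0) ->
  complete_disk (f @` D).
Proof.
move=> [sD cD] kf; apply: (fast_complete adisk_image).
  move=> v' hv.
  (* The preimages [w k] of [v'] tend to 0, so the kernel vectors [w 0 - w k] tend to [w 0], which
     therefore lies in the kernel. *)
  have /choice[w hw] k : exists w, dil D (2 ^- k) w /\ f w = v'.
    by have /(dil_imageP _ (exp2V_gt0 _ _))[w ? ?] := hv _ (exp2V_gt0 R k); exists w.
  rewrite -(hw 0%N).2; apply: (kf (fun k => w 0%N - w k)).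
    by move=> n; rewrite linearB !(hw _).2 subrr.
  move=> e e0; have [k hk] := exp2V_small e0; exists k => n kn.
  rewrite addrAC subrr sub0r; apply: dilN => //.
  by apply: (dil_le hD (exp2V_gt0 R n)); [exact: hk|exact: (hw n).1].
move=> x' fx'.
have /choice[w hw] k : exists w, dil D (2 ^- k) w /\ f w = x' k.+1 - x' k.
  by have /(dil_imageP _ (exp2V_gt0 _ _))[w ? ?] := fx' k; exists w.
pose s k := \sum_(i < k) w i.
have [|l hl] := cD s.
  apply: fast_mcauchy => // k; rewrite /s big_ord_recr/= addrAC subrr add0r.
  exact: (hw k).1.
have fs k : f (s k) = x' k - x' 0%N.
  elim: k => [|k IH]; first by rewrite /s big_ord0 linear0 subrr.
  rewrite /s big_ord_recr/= linearD (hw k).2 -/(s k) IH.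
  by rewrite addrC subrKA.
exists (f l + x' 0%N) => e e0; have [N h] := hl e e0; exists N => n Nn.
apply/dil_imageP => //; exists (s n - l); first exact: h.
by rewrite linearB fs opprD addrA addrAC.
Qed.

End LinearImage.

(** * Bounded sets and unconditional sums *)

Lemma fset_sumD (T : choiceType) (V : zmodType) (X0 X : {fset T}) (F : T -> V) :
  (X0 `<=` X)%fset ->
  \sum_(t <- X) F t = \sum_(t <- X0) F t + \sum_(t <- (X `\` X0)%fset) F t.
Proof.
move=> /fsubsetP sX; rewrite -big_cat/=; apply: perm_big.
apply: uniq_perm; rewrite ?fset_uniq// ?cat_uniq ?fset_uniq ?andbT/=.
  by apply/hasPn => t; rewrite inE => /andP[].
by move=> t; rewrite mem_cat inE; case: (boolP (t \in X0)) => // /sX ->.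
Qed.

Section AdiskSums.
Variables (R : realType) (V : lmodType R) (T : choiceType) (D : set V).
Hypothesis hD : adisk D.
Implicit Types (a : T -> R) (y : T -> V).

(** The tail is rescaled by its total weight, so that the two-term condition applies. Indices with
    coefficient 0 put no condition on [y]: in use, only the vectors over the support are known to
    lie in [D]. *)
Lemma adisk_sum (X : seq T) a y : \sum_(t <- X) `|a t| <= 1 ->
  (forall t, a t != 0 -> D (y t)) -> D (\sum_(t <- X) a t *: y t).
Proof.
move=> X1 Dy; elim: X a X1 Dy => [|t X IH] a; first by rewrite !big_nil => *; exact: hD.1.
rewrite !big_cons => X1 Dy.
have Day u : D u -> `|a t| + (\sum_(t <- X) `|a t|) <= 1 ->
    D (a t *: y t + (\sum_(t <- X) `|a t|) *: u).
  move=> Du; have [->|at0] := eqVneq (a t) 0.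
    rewrite scale0r -(scale0r (0 : V)) normr0 => ?; apply: hD.2 => //; last exact: hD.1.
    by rewrite normr0 ger0_norm// sumr_ge0.
  by move=> ?; apply: hD.2 => //; [rewrite (@ger0_norm _ (\sum_(_ <- _) _))// sumr_ge0|exact: Dy].
set S := \sum_(t <- X) `|a t| in X1 Day *.
have S_ge0 : 0 <= S by exact: sumr_ge0.
have [S0|S0] := eqVneq S 0.
  have aX s : s \in X -> a s = 0.
    move=> sX; apply/eqP; rewrite -normr_le0 -S0 /S.
    by rewrite (big_rem s)//= lerDl sumr_ge0.
  rewrite big_seq big1 => [|s /aX ->]; last by rewrite scale0r.
  by have := Day 0 hD.1 X1; rewrite scaler0.
have -> : \sum_(t <- X) a t *: y t = S *: \sum_(t <- X) (a t / S) *: y t.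
  by rewrite scaler_sumr; apply: eq_bigr => s _; rewrite scalerA mulrC divfK.
apply: Day => //; apply: IH => [|s].
  under eq_bigr do rewrite normrM normfV (ger0_norm S_ge0).
  by rewrite -mulr_suml -/S divff.
by rewrite mulf_eq0 negb_or => /andP[+ _]; exact: Dy.
Qed.

Lemma dil_sum (X : seq T) a y r : 0 < r -> \sum_(t <- X) `|a t| <= r ->
  (forall t, a t != 0 -> D (y t)) -> dil D r (\sum_(t <- X) a t *: y t).
Proof.
move=> r0 Xr Dy; rewrite /dil scaler_sumr.
under eq_bigr do rewrite scalerA; apply: adisk_sum => [|t].
  under eq_bigr do rewrite normrM normfV (gtr0_norm r0).
  by rewrite -mulr_sumr ler_pdivrMl// mulr1.
by rewrite mulf_eq0 negb_or => /andP[_]; exact: Dy.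
Qed.

End AdiskSums.

(** [Z k] comes within [2^-k] of the supremum of the finite sums, so a finite set disjoint from it
    carries at most [2^-k]; unions make the sets increase. This replaces unconditional sums by
    sequences. *)
Lemma l1_tails (R : realType) (T : choiceType) (a : T -> R) (M : R) :
  (forall X : {fset T}, \sum_(t <- X) `|a t| <= M) ->
  exists X : nat -> {fset T},
    [/\ forall k, (X k `<=` X k.+1)%fset &
        forall k (Y : {fset T}), [disjoint Y & X k]%fset ->
          \sum_(t <- Y) `|a t| <= 2 ^- k].
Proof.
move=> aM; pose S := [set s : R | exists X : {fset T}, s = \sum_(t <- X) `|a t|].
have S0 : S !=set0 by exists (\sum_(t <- fset0) `|a t|), fset0.
have Sb : has_ubound S by exists M => _ [X ->].
have /choice[Z hZ] k : exists X : {fset T}, sup S - 2 ^- k < \sum_(t <- X) `|a t|.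
  have [_ [X ->] hX] := sup_adherent (exp2V_gt0 R k) (conj S0 Sb).
  by exists X.
pose X := nat_rect (fun=> {fset T}) (Z 0%N) (fun k A => A `|` Z k.+1)%fset.
have ZX k : (Z k `<=` X k)%fset by case: k => [|k]; rewrite ?fsubset_refl ?fsubsetUr.
exists X; split=> [k|]; first exact: fsubsetUl.
move=> k Y YX.
have YZ : [disjoint Y & Z k]%fset by apply: fdisjointWr YX.
have : \sum_(t <- (Y `|` Z k)%fset) `|a t| <= sup S.
  by apply: ub_le_sup => //; exists (Y `|` Z k)%fset.
rewrite (@fset_sumD _ _ (Z k)) ?fsubsetUr// fsetDUl fsetDv fsetU0.
have /fsetDidPl -> := YZ.
by have := hZ k; lra.
Qed.

HB.instance Definition _ (R : realType) (E F : cborn R) (f : cborn_hom E F) :=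
  GRing.isLinear.Build R E F *:%R f (cborn_linear f).

Section Bounded.
Variable R : realType.
Implicit Types E F : cborn R.

(** Equivalent bases have the same bounded sets, so one representative of the class suffices. *)
Lemma cborn_base E : exists2 B : set (set E), is_base B &
  forall A, bounded A <-> exists2 D, B D & A `<=` D.
Proof.
have [B hB EB] := basesP E; exists B => // A; split.
  move=> [B']; rewrite EB => -[_ [_ BB']] [D B'D AD].
  by have [D' BD' DD'] := BB' D B'D; exists D' => //; exact: subset_trans DD'.
move=> [D BD AD]; exists B; last by exists D.
by rewrite EB; split=> //; exact: base_equiv_refl.
Qed.

Lemma bounded_base (V : lmodType R) (B : set (set V)) (hB : is_base B)
    (A : set (cborn_of_base hB)) : bounded A <-> exists2 D, B D & A `<=` D.
Proof.
split.
  move=> [B'] /= [_ [_ BB']] [D B'D AD].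
  by have [D' BD' DD'] := BB' D B'D; exists D' => //; exact: subset_trans DD'.
move=> [D BD AD]; exists B; last by exists D.
by split=> //; exact: base_equiv_refl.
Qed.

Lemma bounded_subset E (A A' : set E) : A `<=` A' -> bounded A' -> bounded A.
Proof.
by move=> AA' [B EB [D BD AD]]; exists B => //; exists D => //; exact: subset_trans AD.
Qed.

Definition bdisk E (D : set E) := [/\ adisk D, complete_disk D & bounded D].

Lemma base_bdisk E (B : set (set E)) D : is_base B ->
  (forall A, bounded A <-> exists2 D, B D & A `<=` D) -> B D -> bdisk D.
Proof.
move=> hB EB BD; have bD := base_banach hB BD.
have aD : adisk D.
  apply: disk_adisk; first exact: base_disk BD.
  by have [[t [d Dd _]] _ _] := bD; exists d.
by split=> //; [exact: banach_complete|apply/EB; exists D].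
Qed.

Lemma bounded_bdisk E (A : set E) : bounded A -> exists2 D, bdisk D & A `<=` D.
Proof.
have [B hB EB] := cborn_base E => /EB[D BD AD]; exists D => //.
exact: base_bdisk BD.
Qed.

Lemma boundedU E (A A' : set E) : bounded A -> bounded A' -> bounded (A `|` A').
Proof.
have [B hB EB] := cborn_base E => /EB[D BD AD] /EB[D' BD' AD'].
apply/EB; eexists; first exact: base_add hB _ _ BD BD'.
have [[D0 _] _ _] := base_bdisk hB EB BD; have [[D'0 _] _ _] := base_bdisk hB EB BD'.
move=> v /= [/AD Dv|/AD' Dv]; [exists v => //; exists 0 => //; rewrite addr0//|].
by exists 0 => //; exists v => //; rewrite add0r.
Qed.

Lemma boundedD E (A A' : set E) : bounded A -> bounded A' ->
  bounded [set v | exists2 d, A d & exists2 d', A' d' & v = d + d'].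
Proof.
have [B hB EB] := cborn_base E => /EB[D BD AD] /EB[D' BD' AD'].
apply/EB; eexists; first exact: base_add hB _ _ BD BD'.
by move=> v /= [d /AD Dd [d' /AD' Dd' ->]]; exists d => //; exists d'.
Qed.

Lemma boundedZ E (r : R) (A : set E) : 0 < r -> bounded A -> bounded ( *:%R r @` A).
Proof.
have [B hB EB] := cborn_base E => r0 /EB[D BD AD].
apply/EB; eexists; first exact: base_scale hB _ _ r0 BD.
exact: image_subset.
Qed.

Lemma bounded_dil E (r : R) (A : set E) : 0 < r -> bounded A ->
  bounded [set v | dil A r v].
Proof.
move=> r0 /(boundedZ r0); apply: bounded_subset => v Av; exists (r^-1 *: v) => //.
by rewrite scalerA divff ?scale1r// gt_eqF.
Qed.

Lemma bounded_finite (I : choiceType) E (X : {fset I}) (A : I -> set E) :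
  (forall i, bounded (A i)) -> bounded (\bigcup_(i in [set` X]) A i).
Proof.
move=> bA; elim/finSet_rect: X => X IH.
have [->|[i iX]] := fset_0Vmem X.
  by apply: bounded_subset (bounded1 (0 : E)) => v [].
rewrite -(fsetD1K iX).
apply: (bounded_subset (A' := A i `|` \bigcup_(j in [set` (X `\ i)%fset]) A j)).
  move=> v [j /=]; rewrite !inE => /orP[/eqP -> ?|jX Ajv]; first by left.
  by right; exists j => //=; rewrite !inE.
by apply: boundedU => //; apply: IH; exact: fproperD1.
Qed.

Lemma bdisk2 E (D D' : set E) : bdisk D -> bdisk D' ->
  exists D'', [/\ bdisk D'', D `<=` D'' & D' `<=` D''].
Proof.
move=> [_ _ bD] [_ _ bD']; have [D'' hD'' DD] := bounded_bdisk (boundedU bD bD').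
by exists D''; split=> //; apply: subset_trans DD; [left|right].
Qed.

Lemma bdisk_image E F (f : cborn_hom E F) (D : set E) : bdisk D ->
  exists2 D', bdisk D' & f @` D `<=` D'.
Proof. by move=> [_ _ bD]; apply: bounded_bdisk; exact: cborn_bounded. Qed.

Lemma dil_subset E (D D' : set E) e v : D `<=` D' -> dil D e v -> dil D' e v.
Proof. by apply. Qed.

Lemma dil_hom E F (f : cborn_hom E F) (D : set E) D' e v : f @` D `<=` D' ->
  dil D e v -> dil D' e (f v).
Proof. by move=> fD Dv; apply: fD; exists (e^-1 *: v) => //; rewrite linearZ. Qed.

Lemma mcvg_hom E F (f : cborn_hom E F) (D : set E) D' x l : f @` D `<=` D' ->
  mcvg D x l -> mcvg D' (f \o x) (f l).
Proof.
move=> fD h e /h[N hN]; exists N => n /hN /(dil_hom fD).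
by rewrite linearB.
Qed.

(** The subspaces that can be divided out: closedness in each bounded complete disk is what keeps
    the image of such a disk complete. *)
Definition bclosed E (N : set E) :=
  [/\ N 0, forall (a : R) v w, N v -> N w -> N (a *: v + w) &
      forall D x l, bdisk D -> (forall n, N (x n)) -> mcvg D x l -> N l].

Lemma ker_bclosed E F (f : cborn_hom E F) : bclosed [set v | f v = 0].
Proof.
split=> /=; first exact: linear0.
  by move=> a v w fv fw; rewrite linearD linearZ /= fv fw scaler0 addr0.
move=> D x l bD fx xl; have [D' [aD' [sD' _] _] fD] := bdisk_image f bD.
have := mcvg_hom fD xl.
have -> : f \o x = fun=> 0 by apply/funext => n; exact: fx.
move=> h; apply: (mcvg_uniq aD' sD') h _ => e e0; exists 0%N => n _.
by rewrite subr0; exact: dil0.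
Qed.

Section UnconditionalSums.
Variable T : choiceType.
Implicit Types (X : {fset T}).

Definition is_sum E (z : T -> E) (l : E) := exists2 D, bdisk D &
  forall e, 0 < e -> exists X0, forall X, (X0 `<=` X)%fset ->
    dil D e (\sum_(t <- X) z t - l).

Lemma is_sum_lin E (a : R) (z z' : T -> E) l l' : is_sum z l -> is_sum z' l' ->
  is_sum (fun t => a *: z t + z' t) (a *: l + l').
Proof.
move=> [D bD h] [D' bD' h']; have [D'' [bD'' DD DD']] := bdisk2 bD bD'.
have [aD _ _] := bD''; exists D'' => // e e0.
have a1 : 0 < `|a| + 1 by rewrite ltr_wpDl.
have [X0 hX0] := h _ (divr_gt0 (half_gt0 e0) a1).
have [X1 hX1] := h' _ (half_gt0 e0).
exists (X0 `|` X1)%fset => X; rewrite fsubUset => /andP[X0X X1X].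
rewrite big_split/= -scaler_sumr opprD addrACA -scalerBr.
apply: dil_half => //; last by apply: dil_subset DD' _; exact: hX1.
apply: dilZ (dil_subset DD (hX0 X X0X)) => //; rewrite ?divr_gt0//.
rewrite mulrCA ger_pMr ?divr_gt0//.
by rewrite ler_pdivrMr// mul1r lerDl.
Qed.

Lemma is_sum_hom E F (f : cborn_hom E F) (z : T -> E) l :
  is_sum z l -> is_sum (f \o z) (f l).
Proof.
move=> [D bD h]; have [D' bD' fD] := bdisk_image f bD; exists D' => // e /h[X0 hX0].
exists X0 => X /hX0 /(dil_hom fD).
by rewrite linearB linear_sum.
Qed.

(** The two sums may converge in different disks; subtracting them with [is_sum_lin] passes to a
    common one, where the zero family converges to the difference. *)
Lemma is_sum_uniq E (z : T -> E) l l' : is_sum z l -> is_sum z l' -> l = l'.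
Proof.
move=> h h'; have := is_sum_lin (-1) h h'.
have -> : (fun t => -1 *: z t + z t) = fun=> 0.
  by apply/funext => t; rewrite scaleN1r addNr.
move=> [D [aD [sD _] _]] h0; apply/eqP; rewrite eq_sym -subr_eq0 -[l' - l]opprK oppr_eq0.
apply/eqP/sD => e /h0[X /(_ X (fsubset_refl _))].
by rewrite big1// sub0r scaleN1r [- l + l']addrC.
Qed.

Lemma is_sum_fin E (z : T -> E) X : (forall t, t \notin X -> z t = 0) ->
  is_sum z (\sum_(t <- X) z t).
Proof.
move=> zX; have [D bD _] := bounded_bdisk (bounded1 (0 : E)); exists D => // e e0.
have [aD _ _] := bD; exists X => Y XY; rewrite (fset_sumD _ XY) addrAC subrr add0r.
rewrite big_seq big1; first exact: dil0.
by move=> t; rewrite inE => /andP[/zX].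
Qed.

(** The partial sums over the sets of [l1_tails] form a fast Cauchy sequence, and every larger
    finite set stays close to its limit because the excess is a small tail. *)
Lemma is_sum_exists E (D : set E) (a : T -> R) (y : T -> E) (M : R) : bdisk D ->
  (forall X, \sum_(t <- X) `|a t| <= M) -> (forall t, a t != 0 -> D (y t)) ->
  exists2 l, is_sum (fun t => a t *: y t) l & dil D (M + 1) l.
Proof.
move=> bD aM Dy; have [aD cD _] := bD.
have M0 : 0 <= M by rewrite (le_trans _ (aM fset0))// sumr_ge0.
have [X [XS Xt]] := l1_tails aM.
pose s k := \sum_(t <- X k) a t *: y t.
have tail k Y : [disjoint Y & X k]%fset -> dil D (2 ^- k) (\sum_(t <- Y) a t *: y t).
  by move=> /Xt XY; apply: dil_sum => //; exact: exp2V_gt0.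
have disj (A B : {fset T}) : [disjoint (A `\` B) & B]%fset.
  by apply/fdisjointP => t; rewrite inE => /andP[].
have [l hl] : exists l, mcvg D s l.
  apply: cD.2; apply: fast_mcauchy => // k; rewrite /s (fset_sumD _ (XS k)).
  by rewrite addrAC subrr add0r; exact: tail.
exists l.
  exists D => // e e0; have [k1 h1] := hl _ (half_gt0 e0).
  have [k2 h2] := exp2V_small (half_gt0 e0).
  pose k := maxn k1 k2; exists (X k) => Y XY.
  rewrite (fset_sumD _ XY) addrAC; apply: dil_half => //.
    by apply: h1; rewrite leq_maxl.
  apply: dil_le (exp2V_gt0 R k) _ (tail k _ (disj _ _)) => //.
  by apply: h2; rewrite leq_maxr.
have [N hN] := hl _ (half_gt0 ltr01).
(* [M] may be 0 while dilates need a positive factor; the surplus 1 is shared between the partial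
   sum and its distance to the limit. *)
rewrite -(subKr (s N) l); have -> : M + 1 = (M + 1 / 2) + 1 / 2 by lra.
apply: dilB => //; [by rewrite ltr_wpDl| |exact: hN].
by apply: dil_sum => //; [rewrite ltr_wpDl|rewrite (le_trans (aM _))// lerDl].
Qed.

End UnconditionalSums.
End Bounded.

(** * Spaces of summable families *)

(* Interface shared by the coproduct of the spaces l^1 over the fibres of [pi] and
   by the Banach space l^1(T) (for constant [pi]). *)
Record l1space (R : realType) (T I : smallType) (pi : T -> I) := L1Space {
  l1_carrier :> cborn R;
  coef : l1_carrier -> T -> R;
  unitv : T -> l1_carrier;
  coef_lin : forall a v w t, coef (a *: v + w) t = a * coef v t + coef w t;
  coef_unitv : forall s t, coef (unitv s) t = (`[< s = t >])%:R;
  coef_bounded : forall A, bounded A -> exists (F : {fset {classic I}}) (M : R),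
    forall v, A v -> (forall t, coef v t != 0 -> (pi t : {classic I}) \in F) /\
      forall X : {fset {classic T}}, \sum_(t <- X) `|coef v t| <= M;
  unitv_bounded : forall i, bounded [set unitv t | t in [set t | pi t = i]];
  coef_sum : forall v, is_sum (fun t : {classic T} => coef v t *: unitv t) v }.

Section Free.
Variables (R : realType) (T I : smallType) (pi : T -> I) (X : l1space R pi).
Implicit Types (F : cborn R).

(** Morphisms preserve unconditional sums, and [v] is the sum of its coefficients times unit
    vectors, so only the support of [v] counts. *)
Lemma l1space_ext F (f g : cborn_hom X F) v :
  (forall t, coef v t != 0 -> f (unitv X t) = g (unitv X t)) -> f v = g v.
Proof.
move=> fg; apply: is_sum_uniq (is_sum_hom g (coef_sum v)).
have -> : g \o (fun t : {classic T} => coef v t *: unitv X t) =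
          f \o (fun t : {classic T} => coef v t *: unitv X t).
  apply/funext => t /=; rewrite !linearZ /=.
  by have [->|/fg ->] := eqVneq (coef v t) 0; rewrite ?scale0r.
exact: is_sum_hom (coef_sum v).
Qed.

Lemma l1space_eq F (f g : cborn_hom X F) :
  (forall t, f (unitv X t) = g (unitv X t)) -> f = g.
Proof. by move=> fg; apply: cborn_hom_eq => v; apply: l1space_ext => t _. Qed.

(** A bounded set involves finitely many fibres, whose vectors [y t] lie in one complete disk; the
    uniform bound on the coefficients then keeps all sums in one dilate of it. *)
Lemma l1space_sum F (y : T -> F) (A : set X) :
  (forall i, bounded [set y t | t in [set t | pi t = i]]) -> bounded A ->
  exists2 D : set F, bounded D & forall v, A v -> exists2 l, D l &
    is_sum (fun t : {classic T} => coef v t *: y t) l.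
Proof.
move=> by_ /coef_bounded[J [M hA]].
have [D bD yD] := bounded_bdisk (bounded_finite (I := {classic I}) J by_).
have [->|/set0P[v0 Av0]] := eqVneq A set0; first by exists D => //; case: bD.
have M0 : 0 < M + 1.
  have /hA[_ /(_ fset0)] := Av0; rewrite big_seq_fset0 => M0; exact: ltr_wpDl.
exists [set v | dil D (M + 1) v]; first by apply: bounded_dil => //; case: bD.
move=> v /hA[hv vM].
have [t vt|l hl Dl] := is_sum_exists (y := y : {classic T} -> _) bD vM.
  by apply: yD; exists (pi t) => /=; [exact: hv|exists t].
by exists l.
Qed.

Lemma l1space_univ F (y : T -> F) :
  (forall i, bounded [set y t | t in [set t | pi t = i]]) ->
  exists f : cborn_hom X F, forall t, f (unitv X t) = y t.
Proof.
(* The default 0 is never taken: [fP] shows that the sum exists. *)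
move=> by_; pose f (v : X) : F := xget 0 (is_sum (fun t : {classic T} => coef v t *: y t)).
have fP v : is_sum (fun t : {classic T} => coef v t *: y t) (f v).
  have [D _ /(_ v erefl)[l _ hl]] := l1space_sum by_ (bounded1 v).
  exact: xgetI hl.
have f_lin : linear f.
  move=> a v w; apply: is_sum_uniq (fP _) _.
  have := is_sum_lin a (fP v) (fP w); congr is_sum; apply/funext => t.
  by rewrite coef_lin scalerDl scalerA.
have f_bounded A : bounded A -> bounded (f @` A).
  move=> /(l1space_sum by_)[D bD hD]; apply: bounded_subset bD => _ [v /hD[l Dl hl] <-].
  by rewrite (is_sum_uniq (fP v) hl).
exists (CBornHom f_lin f_bounded) => t /=; apply: is_sum_uniq (fP _) _.
have := @is_sum_fin R {classic T} F (fun s => coef (unitv X t) s *: y s)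
  [fset (t : {classic T})]%fset.
rewrite big_seq_fset1 coef_unitv asboolT// scale1r; apply=> s; rewrite inE coef_unitv => st.
by case: asboolP => [ts|_]; [rewrite ts eqxx in st|rewrite scale0r].
Qed.

End Free.

(** * The Banach space l^1(S) as a free space *)

Section L1Norm.
Variables (R : realType) (S : smallType).
Local Notation l1 := (l1 R S).
Implicit Types (v w : l1).

Lemma l1_linE (a : R) v w s : (a *: v + w) s = a * v s + w s.
Proof. by []. Qed.

Lemma l1_norm_fset v (X : {fset {classic S}}) : \sum_(s <- X) `|v s| <= `|v|.
Proof.
by rewrite -[X in X in \sum_(s <- X) _]set_fsetK; apply: l1_norm_ge; exact: finite_fset.
Qed.

Lemma l1_norm_fset_le v (M : R) :
  (forall X : {fset {classic S}}, \sum_(s <- X) `|v s| <= M) -> `|v| <= M.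
Proof. by move=> vM; apply: l1_norm_le. Qed.

Lemma restrict_subproof v (p : pred S) :
  (fun s : {classic S} => if p s then v s else 0 : R^o) \in @l1_mem R S.
Proof.
apply: (@l1_mem_bound _ _ _ (`|v|)) => X fX; apply: le_trans (l1_norm_fset v _).
by apply: ler_sum => s _; case: (p s); rewrite ?normr0.
Qed.

Definition l1_restrict v p : l1 := L1 (restrict_subproof v p).

Lemma l1_restrict_norm v p : `|l1_restrict v p| <= `|v|.
Proof.
apply: l1_norm_fset_le => X; apply: le_trans (l1_norm_fset v X).
by apply: ler_sum => s _ /=; case: (p s); rewrite ?normr0.
Qed.

Lemma delta_fset_le (s : {classic S}) (X : {fset {classic S}}) :
  \sum_(t <- X) `|(`[< s = t >])%:R| <= 1 :> R.
Proof.
have [sX|sX] := boolP (s \in X).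
  rewrite (big_fsetD1 _ sX)/= big_seq big1 => [|t].
    by rewrite asboolT// normr1 addr0.
  rewrite !inE => /andP[ts _]; case: asboolP => [st|_]; last by rewrite normr0.
  by rewrite st eqxx in ts.
rewrite big_seq big1// => t tX; case: asboolP => [st|_]; last by rewrite normr0.
by rewrite st tX in sX.
Qed.

Lemma delta_subproof (s : S) :
  (fun t : {classic S} => (`[< s = t >])%:R : R^o) \in @l1_mem R S.
Proof. by apply: (@l1_mem_bound _ _ _ 1) => X fX; exact: delta_fset_le. Qed.

Definition l1_delta s : l1 := L1 (delta_subproof s).

Lemma l1_delta_norm s : `|l1_delta s| <= 1.
Proof. by apply: l1_norm_fset_le => X; exact: delta_fset_le. Qed.

Lemma l1_sumE (X : seq {classic S}) (z : {classic S} -> l1) t :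
  (\sum_(s <- X) z s) t = \sum_(s <- X) (z s t : R).
Proof. by elim: X => [|s X IH]; rewrite ?big_nil// !big_cons -IH. Qed.

Lemma l1_partial_sum v (X : {fset {classic S}}) :
  \sum_(s <- X) v s *: l1_delta s = l1_restrict v [pred s | (s : {classic S}) \in X].
Proof.
apply/val_inj/funext => t; rewrite /= l1_sumE.
rewrite (eq_bigr (fun s => v s * (`[< s = t >])%:R))//.
have delta0 (s : {classic S}) : s != t -> v s * (`[< s = t >])%:R = 0 :> R.
  by case: asboolP => [->|_ _]; [rewrite eqxx|rewrite mulr0].
rewrite /=; case: ifP => [tX|/negbT tX].
  rewrite (big_fsetD1 _ tX)/= big_seq big1 => [|s].
    by rewrite asboolT// addr0 mulr1.
  by rewrite !inE => /andP[st _]; exact: delta0.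
rewrite big_seq big1// => s sX; apply: delta0.
by apply: contraNneq tX => <-.
Qed.

(** Up to sign, the error is [v] restricted to the complement of the finite set, hence a tail. *)
Lemma l1_delta_sum v (e : R) : 0 < e -> exists X0 : {fset {classic S}},
  forall X, (X0 `<=` X)%fset -> `|\sum_(s <- X) v s *: l1_delta s - v| <= e.
Proof.
move=> e0; have [X [_ hX]] := l1_tails (l1_norm_fset v).
have [k hk] := exp2V_small e0; exists (X k) => Y XY.
apply: (le_trans _ (hk k (leqnn _))); rewrite l1_partial_sum.
apply: l1_norm_fset_le => Z; apply: le_trans (hX k (Z `\` Y)%fset _).
  rewrite (big_fsetID _ (mem Y) Z)/= big_seq big1 ?add0r; last first.
    move=> s; rewrite !inE/= => /andP[_ sY].
    by rewrite [X in `|X|](_ : _ = 0) ?normr0// /GRing.add/= sY subrr.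
  rewrite le_eqVlt; apply/orP; left; apply/eqP.
  have -> : [fset x in Z | x \notin Y]%fset = (Z `\` Y)%fset.
    by apply/fsetP => s; rewrite !inE andbC.
  rewrite big_seq [RHS]big_seq; apply: eq_bigr => s; rewrite inE => /andP[sY _].
  by rewrite -normrN; congr (`|_|); rewrite /GRing.add/= (negbTE sY) add0r opprK.
apply: fdisjointWr XY _.
by apply/fdisjointP => s; rewrite inE => /andP[].
Qed.

End L1Norm.

Section L1Space.
Variables (R : realType) (S : smallType).
Local Notation l1b := (cborn_of_banach (l1 R S)).

Lemma banach_boundedP (V : completeNormedModType R) (A : set (cborn_of_banach V)) :
  bounded A <-> exists2 r : R, 0 < r & forall v : V, A v -> `|v| < r.
Proof.
apply: (iff_trans (bounded_base A)); split.
  by move=> [_ [r /= r0 <-] Ar]; exists r => // v /Ar; rewrite ball0E.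
move=> [r r0 Ar]; exists (ball (0 : V) r); first by exists r.
by move=> v /Ar; rewrite ball0E.
Qed.

Lemma ball_bdisk (V : completeNormedModType R) (r : R) : 0 < r ->
  bdisk (ball (0 : V) r : set (cborn_of_banach V)).
Proof.
move=> r0; apply: (@base_bdisk R (cborn_of_banach V) _ _ (ball_base_is_base V)).
  by move=> A; exact: bounded_base.
by exists r.
Qed.

Lemma dil_ballE (V : completeNormedModType R) (e : R) (v : V) : 0 < e ->
  dil (ball (0 : V) 1) e v = (`|v| < e).
Proof.
move=> e0; rewrite /dil ball0E normrZ gtr0_norm ?invr_gt0//.
by rewrite mulrC ltr_pdivrMr// mul1r.
Qed.

Lemma l1_coef_bounded (A : set l1b) : bounded A ->
  exists (F : {fset {classic unit}}) (M : R),
    forall v : l1 R S, A v -> (forall t, v t != 0 -> (tt : {classic unit}) \in F) /\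
      forall X : {fset {classic S}}, \sum_(t <- X) `|v t| <= M.
Proof.
move=> /banach_boundedP[r r0 Ar].
exists [fset (tt : {classic unit})]%fset, r => v /Ar/ltW vr; split.
  by move=> t _; rewrite inE.
by move=> X; exact: le_trans (l1_norm_fset _ _) vr.
Qed.

Lemma l1_unitv_bounded (i : unit) :
  bounded [set (l1_delta R t : l1b) | t in [set t : S | tt = i]].
Proof.
apply/banach_boundedP; exists 2 => // _ [t _ <-].
by apply: le_lt_trans (l1_delta_norm _ _) _; rewrite ltr1n.
Qed.

Lemma l1_coef_sum (v : l1b) :
  is_sum (fun t : {classic S} => (v : l1 R S) t *: (l1_delta R t : l1b)) v.
Proof.
exists (ball (0 : l1 R S) 1); first exact: ball_bdisk.
move=> e e0; have [X0 hX0] := l1_delta_sum v (half_gt0 e0); exists X0 => X /hX0 h.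
rewrite dil_ballE// (le_lt_trans h)//.
by rewrite ltr_pdivrMr// ltr_pMr// ltr1n.
Qed.

Definition l1_space : l1space R (fun _ : S => tt) :=
  @L1Space R S unit (fun=> tt) l1b (fun v => (v : l1 R S)) (@l1_delta R S)
    (@l1_linE R S) (fun s t => erefl) l1_coef_bounded l1_unitv_bounded l1_coef_sum.

End L1Space.

(** * Summable families supported in finitely many fibres *)

Section L1Sum.
Variables (R : realType) (T I : smallType) (pi : T -> I).

Definition fibres_in (F : {fset {classic I}}) (v : l1 R T) :=
  forall t, v t != 0 -> (pi t : {classic I}) \in F.

Definition fin_fibres : {pred l1 R T} := [pred v | `[< exists F, fibres_in F v >]].

Lemma fibres_in_lin F G (a : R) v w : fibres_in F v -> fibres_in G w ->
  fibres_in (F `|` G)%fset (a *: v + w).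
Proof.
move=> vF wG t; rewrite l1_linE inE.
have [v0|/vF ->//] := eqVneq (v t) 0.
by rewrite v0 mulr0 add0r => /wG ->; rewrite orbT.
Qed.

Lemma fin_fibres_closed : submod_closed fin_fibres.
Proof.
split; first by apply/asboolP; exists fset0 => t; rewrite eqxx.
move=> a v w /asboolP[F vF] /asboolP[G wG]; apply/asboolP; exists (F `|` G)%fset.
exact: fibres_in_lin.
Qed.

HB.instance Definition _ :=
  GRing.isSubmodClosed.Build R (l1 R T) fin_fibres fin_fibres_closed.

Record l1sum := L1Sum { l1sum_val :> l1 R T; _ : l1sum_val \in fin_fibres }.

HB.instance Definition _ := [isSub for l1sum_val].
HB.instance Definition _ := [Choice of l1sum by <:].
HB.instance Definition _ := [SubChoice_isSubLmodule of l1sum by <:].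

Implicit Types (v w : l1sum) (F : {fset {classic I}}) (r : R).

Definition fibre_disk F r : set l1sum := [set v : l1sum | fibres_in F v /\ `|l1sum_val v| < r].

Lemma l1sum_linE (a : R) v w t : (a *: v + w) t = a * v t + w t.
Proof. by []. Qed.

Lemma fibre_disk_adisk F r : 0 < r -> adisk (fibre_disk F r).
Proof.
move=> r0; split; first by split; [move=> t; rewrite eqxx|rewrite normr0].
move=> a b v w ab [vF vr] [wF wr]; split.
  rewrite -(fsetUid F); apply: fibres_in_lin => //; rewrite -[_ *: _]addr0 -(fsetU0 F).
  by apply: fibres_in_lin => // t; rewrite eqxx.
rewrite (le_lt_trans (ler_normD _ _))// !normrZ.
(* The bound is strict: for [a = 0] strictness comes from [w], otherwise from [v]. *)
have [a0|a0] := eqVneq a 0.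
  rewrite a0 normr0 mul0r add0r; move: ab; rewrite a0 normr0 add0r => b1.
  by apply: le_lt_trans wr; rewrite ler_piMl.
apply: (@lt_le_trans _ _ (`|a| * r + `|b| * r)).
  by apply: ltr_leD; [rewrite ltr_pM2l// normr_gt0|rewrite ler_wpM2l// ltW].
by rewrite -mulrDl ler_piMl// ltW.
Qed.

Lemma fibres_inZ F (a : R) v : fibres_in F v -> fibres_in F (a *: v).
Proof.
move=> vF t; rewrite [X in X != _](_ : _ = a * v t)// mulf_eq0 negb_or.
by move=> /andP[_ /vF].
Qed.

Lemma dil_fibre_disk F r e v : 0 < e ->
  dil (fibre_disk F r) e v <-> fibre_disk F (e * r) v.
Proof.
move=> e0; have vE : v = e *: (e^-1 *: v).
  by rewrite scalerA divff ?scale1r// gt_eqF.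
have nE : (`|l1sum_val (e^-1 *: v)| < r) = (`|l1sum_val v| < e * r).
  rewrite [X in `|X|](_ : _ = e^-1 *: l1sum_val v)//.
  by rewrite normrZ gtr0_norm ?invr_gt0// ltr_pdivrMl.
split=> -[vF vr]; split.
- by rewrite vE; exact: fibres_inZ.
- by rewrite -nE.
- exact: fibres_inZ.
- by rewrite nE.
Qed.

Lemma fibre_disk_complete F : complete_disk (fibre_disk F 1).
Proof.
split.
  move=> v hv; apply/val_inj/eqP; rewrite -normr_le0; apply/ler_gtP => e e0.
  by have /(dil_fibre_disk _ _ _ e0)[_] := hv e e0; rewrite mulr1 => /ltW.
move=> x cx.
have /cvg_ex[l xl] : cvg ((fun n => l1sum_val (x n)) @ \oo).
  apply: cauchy_cvg; apply/cauchy_ballP => e e0.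
  have [N xN] := cx e e0.
  pose A : set (l1 R T) := (fun n => l1sum_val (x n)) @` [set n | (N <= n)%N].
  have FA : ((fun n => l1sum_val (x n)) @ \oo) A by exists N => // n Nn; exists n.
  exists (A, A) => // -[_ _] /= [[m Nm <-] [n Nn <-]]; rewrite -ball_normE /=.
  have /(dil_fibre_disk _ _ _ e0)[_] := xN m n Nm Nn; by rewrite mulr1.
have [N0 xN0] := cx 1 ltr01.
have xlt (e : R) : 0 < e -> exists N : nat, forall n, (N <= n)%N ->
    `|l1sum_val (x n) - l| < e.
  move=> e0; have /cvgrPdist_lt/(_ _ e0)[N _ xN] := xl.
  by exists N => n Nn; rewrite distrC; exact: xN.
(* Late differences vanish outside [F], so the coordinates there are constant from [N0] on; the
   limit differs from [x N0] only over [F] and still meets finitely many fibres. *)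
have lF : fibres_in F (l - l1sum_val (x N0)).
  move=> t; apply: contraNT => tF.
  have x0 n : (N0 <= n)%N -> l1sum_val (x n) t = l1sum_val (x N0) t.
    move=> N0n.
    have /(dil_fibre_disk _ _ _ ltr01)[/(_ t)/contraNT/(_ tF) + _] := xN0 _ _ N0n (leqnn _).
    rewrite [X in X == _](_ : _ = (l1sum_val (x n) t : R) - l1sum_val (x N0) t)//.
    by rewrite subr_eq0 => /eqP.
  rewrite [X in X == _](_ : _ = (l t : R) - l1sum_val (x N0) t)//.
  rewrite -normr_le0; apply/ler_gtP => e /xlt[N hN].
  rewrite -(x0 _ (leq_maxl N0 N)) distrC; apply/ltW/(le_lt_trans _ (hN _ (leq_maxr N0 N))).
  exact: (l1_ev_le (l1sum_val (x (maxn N0 N)) - l)).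
have lfin : l \in fin_fibres.
  have /asboolP[G xG] := valP (x N0).
  apply/asboolP; exists (G `|` F)%fset.
  rewrite -(subrK (l1sum_val (x N0)) l) addrC -[X in X + _]scale1r.
  exact: fibres_in_lin.
exists (L1Sum lfin) => e e0; have [N hN] := xlt e e0.
exists (maxn N0 N) => n; rewrite geq_max => /andP[N0n Nn].
apply/(dil_fibre_disk _ _ _ e0); split; last by rewrite mulr1; exact: hN.
have -> : l1sum_val (x n - L1Sum lfin) =
    (-1) *: (l - l1sum_val (x N0)) + l1sum_val (x n - x N0).
  by rewrite scaleN1r opprB [RHS]addrC subrKA.
rewrite -(fsetUid F); apply: fibres_in_lin => //.
by have /(dil_fibre_disk _ _ _ ltr01)[] := xN0 _ _ N0n (leqnn _).
Qed.

(* The sets [fibre_disk F r] alone are not closed under sums. *)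
Definition l1sum_base : set (set l1sum) := [set D | adisk D /\
  exists F r r', [/\ 0 < r, 0 < r', fibre_disk F r `<=` D & D `<=` fibre_disk F r']].

Lemma l1sum_restrict_subproof v (p : pred T) :
  l1_restrict (l1sum_val v) p \in fin_fibres.
Proof.
have /asboolP[F vF] := valP v; apply/asboolP; exists F => t /=.
by case: (p t); [exact: vF|rewrite eqxx].
Qed.

Lemma l1sum_is_base : is_base l1sum_base.
Proof.
split.
- by move=> D [/adisk_disk].
- move=> v; have /asboolP[F vF] := valP v.
  have v0 : 0 < `|l1sum_val v| + 1 by rewrite ltr_wpDl.
  exists (fibre_disk F (`|l1sum_val v| + 1)); last by split=> //; rewrite ltrDl.
  split; first exact: fibre_disk_adisk.
  by exists F, (`|l1sum_val v| + 1), (`|l1sum_val v| + 1); split.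
- move=> D D' [aD [F [r [r' [r0 r'0 rD Dr']]]]] [aD' [G [s [s' [s0 s'0 sD Ds']]]]].
  split.
    split.
      by exists 0; [exact: aD.1|exists 0; [exact: aD'.1|rewrite addr0]].
    move=> a b _ _ ab [v Dv [v' Dv' ->]] [w Dw [w' Dw' ->]].
    exists (a *: v + b *: w); first exact: aD.2.
    exists (a *: v' + b *: w'); first exact: aD'.2.
    by rewrite !scalerDr addrACA.
  exists (F `|` G)%fset, (Num.min r s), (r' + s'); split.
  + by rewrite lt_min r0.
  + exact: addr_gt0.
  + move=> v [vFG]; rewrite lt_min => /andP[vr vs].
    (* The vector is cut into its part over [F], which lies in [D], and the rest, which is supported
       over [G] and lies in [D']. *)
    pose p := [pred t | (pi t : {classic I}) \in F].
    pose vp := L1Sum (l1sum_restrict_subproof v p).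
    pose vn := L1Sum (l1sum_restrict_subproof v (predC p)).
    exists vp.
      apply: rD; split; last exact: le_lt_trans (l1_restrict_norm _ _) vr.
      by move=> t /=; case: ifP => //; rewrite eqxx.
    exists vn.
      apply: sD; split; last exact: le_lt_trans (l1_restrict_norm _ _) vs.
      move=> t /=; case: ifP => //; last by rewrite eqxx.
      by move=> /negbTE tF /vFG; rewrite inE tF.
    do 2! apply: val_inj; apply/funext => t /=.
    rewrite [RHS](_ : _ = (if p t then v t else 0) + (if predC p t then v t else 0))//.
    by rewrite /=; case: ifP; rewrite ?addr0 ?add0r.
  + move=> _ [v /Dr'[vF vr] [w /Ds'[wG ws] ->]]; split.
      by rewrite -[v]scale1r; exact: fibres_in_lin.
    by rewrite (le_lt_trans (ler_normD _ _))// ltrD.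
- move=> a D a0 [aD [F [r [r' [r0 r'0 rD Dr']]]]]; split.
    split; first by exists 0; [exact: aD.1|rewrite scaler0].
    move=> b c _ _ bc [v Dv <-] [w Dw <-]; exists (b *: v + c *: w).
      exact: aD.2.
    by rewrite scalerDr !scalerA ![a * _]mulrC.
  exists F, (a * r), (a * r'); rewrite !mulr_gt0//; split=> //.
    move=> v /(dil_fibre_disk _ _ _ a0)/rD Dv; exists (a^-1 *: v) => //.
    by rewrite scalerA divff ?scale1r// gt_eqF.
  move=> _ [v /Dr' Dv <-]; apply/(dil_fibre_disk _ _ _ a0).
  by rewrite /dil scalerA mulVf ?scale1r// gt_eqF.
- move=> D [aD [F [r [r' [r0 r'0 rD Dr']]]]]; apply: complete_banach => //.
  have r1 : 0 < r^-1 by rewrite invr_gt0.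
  (* [D] lies between two multiples of [fibre_disk F 1], so completeness is inherited from the l^1
     norm on the vectors over [F]. *)
  apply: (complete_sandwich (fibre_disk_adisk F ltr01) aD r1 r'0 _ _ (fibre_disk_complete F)).
    move=> v Dv; rewrite /dil invrK; apply: rD; rewrite -[in fibre_disk F r](mulr1 r).
    apply/(dil_fibre_disk _ _ _ r0).
    by rewrite /dil scalerA mulVf ?scale1r// gt_eqF.
  by move=> v /Dr' Dv; apply/(dil_fibre_disk _ _ _ r'0); rewrite mulr1.
Qed.

Definition cborn_l1sum : cborn R := cborn_of_base l1sum_is_base.

Lemma l1sum_boundedP (A : set cborn_l1sum) : bounded A ->
  exists F r, 0 < r /\ A `<=` fibre_disk F r.
Proof.
move=> /bounded_base[D [_ [F [r [r' [_ r'0 _ Dr']]]]] AD].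
by exists F, r'; split=> //; exact: subset_trans Dr'.
Qed.

Lemma fibre_disk_base F r : 0 < r -> l1sum_base (fibre_disk F r).
Proof. by move=> r0; split; [exact: fibre_disk_adisk|exists F, r, r; split]. Qed.

Lemma fibre_disk_bdisk F r : 0 < r ->
  bdisk (fibre_disk F r : set cborn_l1sum).
Proof.
move=> r0; apply: (@base_bdisk R cborn_l1sum _ _ l1sum_is_base).
  by move=> A; exact: bounded_base.
exact: fibre_disk_base.
Qed.

Lemma l1sum_coef_bounded (A : set cborn_l1sum) : bounded A ->
  exists (F : {fset {classic I}}) (M : R), forall v : l1sum, A v ->
    (forall t, v t != 0 -> (pi t : {classic I}) \in F) /\
    forall X : {fset {classic T}}, \sum_(t <- X) `|v t| <= M.
Proof.
move=> /l1sum_boundedP[F [r [r0 Ar]]]; exists F, r => v /Ar[vF /ltW vr].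
by split=> // X; exact: le_trans (l1_norm_fset _ _) vr.
Qed.

Lemma l1sum_unitv_subproof t : l1_delta R t \in fin_fibres.
Proof.
apply/asboolP; exists [fset (pi t : {classic I})]%fset => s /=; rewrite inE.
by case: asboolP => [->//|_]; rewrite eqxx.
Qed.

Definition l1sum_unitv t : l1sum := L1Sum (l1sum_unitv_subproof t).

Lemma l1sum_unitv_bounded i :
  bounded [set (l1sum_unitv t : cborn_l1sum) | t in [set t | pi t = i]].
Proof.
have [_ _] := @fibre_disk_bdisk [fset (i : {classic I})]%fset 2 (ltr0Sn _ _).
apply: bounded_subset => _ [t /= <- <-]; split.
  by move=> s /=; rewrite inE; case: asboolP => [->//|_]; rewrite eqxx.
by apply: le_lt_trans (l1_delta_norm _ _) _; rewrite ltr1n.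
Qed.

Lemma l1sum_val_sum (X : seq {classic T}) (z : {classic T} -> l1sum) :
  l1sum_val (\sum_(t <- X) z t) = \sum_(t <- X) l1sum_val (z t).
Proof. by elim: X => [|t X IH]; rewrite ?big_nil// !big_cons -IH. Qed.

Lemma l1sum_coef_sum (v : cborn_l1sum) :
  is_sum (fun t : {classic T} => (v : l1sum) t *: (l1sum_unitv t : cborn_l1sum)) v.
Proof.
have /asboolP[F vF] := valP (v : l1sum).
exists (fibre_disk F 1); first exact: fibre_disk_bdisk.
move=> e e0; have [X0 hX0] := l1_delta_sum (l1sum_val v) (half_gt0 e0).
exists X0 => X /hX0 h; apply/(dil_fibre_disk _ _ _ e0).
have E : l1sum_val (\sum_(t <- X) (v : l1sum) t *: l1sum_unitv t - v) =
    \sum_(t <- X) (v : l1sum) t *: l1_delta R t - l1sum_val v.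
  rewrite [LHS](_ : _ =
    l1sum_val (\sum_(t <- X) (v : l1sum) t *: l1sum_unitv t) - l1sum_val v)//.
  by rewrite l1sum_val_sum.
split; last first.
  rewrite E mulr1 (le_lt_trans h)//.
  by rewrite ltr_pdivrMr// ltr_pMr// ltr1n.
rewrite E l1_partial_sum -(fsetUid F) addrC -scaleN1r; apply: fibres_in_lin => //.
by move=> t /=; case: ifP; rewrite ?eqxx// => _ /vF.
Qed.

Definition l1sum_space : l1space R pi :=
  @L1Space R T I pi cborn_l1sum (fun v => (v : l1sum)) l1sum_unitv
    l1sum_linE (fun s t => erefl) l1sum_coef_bounded l1sum_unitv_bounded
    l1sum_coef_sum.

End L1Sum.

(** * Quotients *)

Record subspace (R : realType) (V : lmodType R) := Subspace {
  subspace_set :> V -> Prop;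
  subspace0 : subspace_set 0;
  subspace_lin : forall (a : R) v w,
    subspace_set v -> subspace_set w -> subspace_set (a *: v + w) }.

Section QuotientModule.
Variables (R : realType) (V : lmodType R) (N : subspace V).

Lemma subspaceD v w : N v -> N w -> N (v + w).
Proof. by rewrite -{2}[v]scale1r; exact: subspace_lin. Qed.

Lemma subspaceZ a v : N v -> N (a *: v).
Proof. by move=> Nv; rewrite -[_ *: _]addr0; apply: subspace_lin => //; exact: subspace0. Qed.

Lemma subspaceB v w : N v -> N w -> N (v - w).
Proof. by move=> Nv Nw; rewrite -scaleN1r; apply: subspaceD => //; exact: subspaceZ. Qed.

(** The choice is made from the coset as a set: congruent vectors define the same set and receive
    the same representative. The quotient then consists of the fixed vectors of this map. *)
Definition coset_rep (v : V) : V := xget 0 [set w | N (w - v)].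

Lemma coset_repP v : N (coset_rep v - v).
Proof.
rewrite /coset_rep; case: xgetP => // /(_ v) /=.
by rewrite subrr => /(_ (subspace0 N)).
Qed.

Lemma coset_rep_eq v w : N (v - w) -> coset_rep v = coset_rep w.
Proof.
move=> Nvw; rewrite /coset_rep; congr xget; apply/seteqP; split=> u /= Nu.
  by rewrite -(subrKA v); exact: subspaceD.
by rewrite -[u - v](subrKA w) -[w - v]opprB; exact: subspaceB.
Qed.

Lemma coset_rep_idem v : coset_rep (coset_rep v) == coset_rep v.
Proof. by apply/eqP/coset_rep_eq; exact: coset_repP. Qed.

Record quot := Quot { quot_val : V; _ : coset_rep quot_val == quot_val }.

HB.instance Definition _ := [isSub for quot_val].
HB.instance Definition _ := [Choice of quot by <:].

Definition quot_pi v : quot := Quot (coset_rep_idem v).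

Lemma quot_piP v w : quot_pi v = quot_pi w <-> N (v - w).
Proof.
split=> [[vw]|/coset_rep_eq vw]; last exact: val_inj.
rewrite -(subrKA (coset_rep v)); apply: subspaceD.
  by rewrite -opprB -scaleN1r; apply: subspaceZ; exact: coset_repP.
by rewrite vw; exact: coset_repP.
Qed.

Lemma quot_valK : cancel quot_val quot_pi.
Proof. by case=> v hv; apply: val_inj; apply/eqP. Qed.

Definition quot_add (x y : quot) := quot_pi (quot_val x + quot_val y).
Definition quot_opp (x : quot) := quot_pi (- quot_val x).
Definition quot_scale (a : R) (x : quot) := quot_pi (a *: quot_val x).

Lemma quot_piD v w : quot_pi (v + w) = quot_add (quot_pi v) (quot_pi w).
Proof.
apply/quot_piP; rewrite opprD addrACA; apply: subspaceD;
  by rewrite -opprB -scaleN1r; apply: subspaceZ; exact: coset_repP.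
Qed.

Lemma quot_piZ a v : quot_pi (a *: v) = quot_scale a (quot_pi v).
Proof.
apply/quot_piP; rewrite -scalerBr; apply: subspaceZ.
by rewrite -opprB -scaleN1r; apply: subspaceZ; exact: coset_repP.
Qed.

Lemma quot_surj (P : quot -> Prop) : (forall v, P (quot_pi v)) -> forall x, P x.
Proof. by move=> h x; rewrite -[x]quot_valK. Qed.

Fact quot_addA : associative quot_add.
Proof.
elim/quot_surj=> u; elim/quot_surj=> v; elim/quot_surj=> w.
by rewrite -!quot_piD addrA.
Qed.

Fact quot_addC : commutative quot_add.
Proof. by move=> x y; rewrite /quot_add addrC. Qed.

Fact quot_add0 : left_id (quot_pi 0) quot_add.
Proof. by elim/quot_surj=> v; rewrite -quot_piD add0r. Qed.

Fact quot_addN : left_inverse (quot_pi 0) quot_opp quot_add.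
Proof.
move=> x; rewrite /quot_opp -{2}[x]quot_valK -quot_piD.
by rewrite addNr.
Qed.

HB.instance Definition _ :=
  GRing.isZmodule.Build quot quot_addA quot_addC quot_add0 quot_addN.

Fact quot_scaleA a b (x : quot) : quot_scale a (quot_scale b x) = quot_scale (a * b) x.
Proof. by elim/quot_surj: x => v; rewrite -!quot_piZ scalerA. Qed.

Fact quot_scale1 : left_id 1 quot_scale.
Proof. by elim/quot_surj=> v; rewrite -quot_piZ scale1r. Qed.

Fact quot_scaleDr : right_distributive quot_scale +%R.
Proof.
move=> a; elim/quot_surj=> v; elim/quot_surj=> w.
by rewrite -[_ + _]quot_piD -!quot_piZ -[RHS]quot_piD scalerDr.
Qed.

Fact quot_scaleDl (x : quot) : {morph quot_scale^~ x : a b / a + b}.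
Proof.
by move=> a b; elim/quot_surj: x => v; rewrite -!quot_piZ -[RHS]quot_piD scalerDl.
Qed.

HB.instance Definition _ := GRing.Zmodule_isLmodule.Build R quot
  quot_scaleA quot_scale1 quot_scaleDr quot_scaleDl.

Fact quot_pi_linear : linear quot_pi.
Proof. by move=> a v w; rewrite quot_piD quot_piZ. Qed.

HB.instance Definition _ := GRing.isLinear.Build R V quot *:%R quot_pi quot_pi_linear.

Lemma quot_pi0 v : quot_pi v = 0 <-> N v.
Proof. by apply: (iff_trans (quot_piP v 0)); rewrite subr0. Qed.

End QuotientModule.

Section Quotient.
Variable R : realType.
Implicit Types (E F Q : cborn R).

(* The kernel of [q] is then the closed subspace generated by [N]. *)
Definition is_quot E (N : set E) Q (q : cborn_hom E Q) :=
  (forall v, N v -> q v = 0) /\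
  forall F (f : cborn_hom E F), (forall v, N v -> f v = 0) ->
    exists! k : cborn_hom Q F, cborn_comp k q = f.

Definition bornological_quot E Q (q : cborn_hom E Q) :=
  (forall y, exists x, q x = y) /\
  forall A, bounded A -> exists2 A', bounded A' & A `<=` q @` A'.

Section Bclosed.
Variables (E : cborn R) (N : set E).
Hypothesis hN : bclosed N.

Let Ns : subspace E := let: And3 h0 hl _ := hN in @Subspace R E N h0 hl.
Let NsE v : Ns v = N v. Proof. by rewrite /Ns; case: hN. Qed.

Let V := quot Ns.
Let pi : {linear E -> V} := @quot_pi R E Ns.

Let B : set (set E) := sval (cid2 (cborn_base E)).
Let hB : is_base B. Proof. exact: (s2valP (cid2 (cborn_base E))). Qed.
Let EB A : bounded A <-> exists2 D, B D & A `<=` D.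
Proof. exact: (s2valP' (cid2 (cborn_base E))). Qed.

Definition quot_base : set (set V) := [set pi @` D | D in B].

Lemma quot_base_is_base : is_base quot_base.
Proof.
split.
- move=> _ [D BD <-]; apply: adisk_disk; apply: adisk_image.
  by have [] := base_bdisk hB EB BD.
- move=> y; rewrite -[y]quot_valK; have [D BD Dv] := base_cover hB (quot_val y).
  by exists (pi @` D); [exists D|exists (quot_val y)].
- move=> _ _ [D BD <-] [D' BD' <-]; eexists; first exact: base_add hB _ _ BD BD'.
  apply/seteqP; split.
    move=> _ [_ [d Dd [d' Dd' ->]] <-]; exists (pi d); first by exists d.
    by exists (pi d'); [exists d'|rewrite linearD].
  move=> _ [_ [d Dd <-] [_ [d' Dd' <-] ->]]; exists (d + d').
    by exists d => //; exists d'.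
  by rewrite linearD.
- move=> r _ r0 [D BD <-]; eexists; first exact: base_scale hB _ _ r0 BD.
  apply/seteqP; split=> _ [_ [d Dd <-] <-].
    by exists (pi d); [exists d|rewrite linearZ].
  by exists (r *: d); [exists d|rewrite linearZ].
- move=> _ [D BD <-]; have [aD cD bD] := base_bdisk hB EB BD.
  apply: complete_banach; first exact: adisk_image.
  (* Closedness of [N] enters here, as closedness of the kernel of the projection. *)
  apply: complete_image => // x l hx xl; apply/quot_pi0; rewrite NsE.
  have [_ _ hcl] := hN; apply: (hcl D x l) => // n.
  by rewrite -NsE; apply/quot_pi0; exact: hx.
Qed.

Definition quot_space : cborn R := cborn_of_base quot_base_is_base.

Lemma quot_proj_bounded (A : set E) : bounded A ->
  bounded (pi @` A : set quot_space).
Proof.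
move=> /EB[D BD AD]; apply/bounded_base; exists (pi @` D); first by exists D.
exact: image_subset.
Qed.

Definition quot_proj : cborn_hom E quot_space :=
  @CBornHom R E quot_space pi (@quot_pi_linear _ _ Ns) quot_proj_bounded.

Lemma quot_proj0 v : quot_proj v = 0 <-> N v.
Proof. by rewrite -NsE; exact: quot_pi0. Qed.

Lemma quot_proj_quot : bornological_quot quot_proj.
Proof.
split=> [y|A]; first by exists (quot_val y); exact: quot_valK.
move=> /bounded_base[_ [D BD <-] AD]; exists D => //.
by have [] := base_bdisk hB EB BD.
Qed.

Lemma quot_proj_is_quot : is_quot N quot_proj.
Proof.
split=> [v /quot_proj0//|F f fN].
have fq v : f (quot_val (quot_proj v)) = f v.
  apply/eqP; rewrite -subr_eq0 -linearB; apply/eqP/fN; rewrite -NsE; exact: coset_repP.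
pose k (y : quot_space) := f (quot_val (y : V)).
have kq v : k (quot_proj v) = f v by exact: fq.
have k_lin : linear k.
  move=> a y z; have [[v <-] [w <-]] := (quot_proj_quot.1 y, quot_proj_quot.1 z).
  by rewrite -linearP !kq linearP.
have k_bounded A : bounded A -> bounded (k @` A).
  move=> /quot_proj_quot.2[A' bA' AA']; apply: bounded_subset (cborn_bounded f bA').
  by move=> _ [_ /AA'[v A'v <-] <-]; exists v => //; rewrite kq.
exists (CBornHom k_lin k_bounded); split; first exact: cborn_hom_eq.
move=> k' k'q; apply: cborn_hom_eq => y; have [v <-] := quot_proj_quot.1 y.
by rewrite /= kq -k'q.
Qed.

End Bclosed.

Lemma bclosed_bigcap E (P : set (set E)) : (forall N, P N -> bclosed N) ->
  bclosed [set v | forall N, P N -> N v].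
Proof.
move=> hP; split=> /=.
- by move=> N /hP[].
- by move=> a v w Pv Pw N PN; have [_ h _] := hP _ PN; apply: h; [exact: Pv|exact: Pw].
- move=> D x l bD hx xl N PN; have [_ _ h] := hP _ PN; apply: (h D x l) => // n.
  exact: hx.
Qed.

(** Intersecting all closed subspaces that contain [N] gives the smallest one without iterating
    limits. Kernels are closed, so a morphism that kills [N] kills the intersection. *)
Lemma is_quot_exists E (N : set E) : exists Q (q : cborn_hom E Q),
  is_quot N q /\ bornological_quot q.
Proof.
pose P := [set N' : set E | bclosed N' /\ N `<=` N'].
have hP : bclosed [set v | forall N', P N' -> N' v] by apply: bclosed_bigcap => N' [].
exists (quot_space hP), (quot_proj hP); split; last exact: quot_proj_quot.
have [kq uq] := quot_proj_is_quot hP; split.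
  by move=> v Nv; apply: kq => N' [_]; exact.
move=> F f fN; apply: uq => v /= hv.
by apply: (hv [set v | f v = 0]); split; [exact: ker_bclosed|exact: fN].
Qed.

Lemma is_quot_uniq E (N : set E) Q (q : cborn_hom E Q) F (k k' : cborn_hom Q F) :
  is_quot N q -> (forall v, k (q v) = k' (q v)) -> k = k'.
Proof.
move=> [qN uq] kk'; have [|h [_ uh]] := uq F (cborn_comp k q).
  by move=> v /qN /= ->; rewrite linear0.
by rewrite -(uh k)// -(uh k')//; apply: cborn_hom_eq => v /=; rewrite kk'.
Qed.

Lemma is_quot_lift E (N : set E) Q (q : cborn_hom E Q) F (f : cborn_hom E F) :
  is_quot N q -> (forall v, N v -> f v = 0) ->
  exists k : cborn_hom Q F, forall v, k (q v) = f v.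
Proof. by move=> [_ uq] /uq[k [<- _]]; exists k. Qed.

Lemma is_quot_iso E (N : set E) Q Q' (q : cborn_hom E Q) (q' : cborn_hom E Q') :
  is_quot N q -> is_quot N q' -> exists (k : cborn_hom Q Q') (k' : cborn_hom Q' Q),
    [/\ forall v, k (q v) = q' v, forall v, k' (q' v) = q v,
        cancel k k' & cancel k' k].
Proof.
move=> hq hq'; have [k kq] := is_quot_lift hq hq'.1.
have [k' kq'] := is_quot_lift hq' hq.1; exists k, k'; split=> //.
  have : cborn_comp k' k = cborn_id Q.
    by apply: (is_quot_uniq hq) => v /=; rewrite kq kq'.
  by move=> + y => /(congr1 (fun f : cborn_hom Q Q => f y)).
have : cborn_comp k k' = cborn_id Q'.
  by apply: (is_quot_uniq hq') => v /=; rewrite kq' kq.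
by move=> + y => /(congr1 (fun f : cborn_hom Q' Q' => f y)).
Qed.

(** The universal property fixes [q] up to isomorphism, and the constructed quotient lifts vectors
    and bounded sets. *)
Lemma is_quot_bornological E (N : set E) Q (q : cborn_hom E Q) :
  is_quot N q -> bornological_quot q.
Proof.
move=> hq; have [Q' [q' [hq' [sq' bq']]]] := is_quot_exists N.
have [k [k' [kq kq' kK kK']]] := is_quot_iso hq hq'.
split=> [y|A bA].
  by have [x hx] := sq' (k y); exists x; rewrite -kq' hx kK.
have [A' bA' AA'] := bq' _ (cborn_bounded k bA); exists A' => // y Ay.
have /AA'[x A'x hx] : (k @` A) (k y) by exists y.
by exists x => //; rewrite -kq' hx kK.
Qed.

Lemma is_quot_transport E E' (N : set E) Q (q : cborn_hom E Q)
    (f : cborn_hom E' E) (g : cborn_hom E E') : is_quot N q ->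
  cancel f g -> cancel g f -> is_quot (f @^-1` N) (cborn_comp q f).
Proof.
move=> hq fK gK; split=> [v /= /hq.1//|F h hN].
have [|k kq] := @is_quot_lift _ _ _ _ _ (cborn_comp h g) hq.
  by move=> v Nv /=; apply: hN; rewrite /= gK.
exists k; split; first by apply: cborn_hom_eq => v /=; rewrite kq /= fK.
move=> k' k'q; apply: (is_quot_uniq hq) => v; rewrite kq /= -k'q /=.
by rewrite gK.
Qed.

End Quotient.

(** * Presentations *)

Section Cardinals.
Variable K : smallType.

Lemma card_lt_le (T U : Type) (A : set T) (B : set U) :
  A #<= B -> card_lt B [set: K] -> card_lt A [set: K].
Proof.
move=> AB [BK KB]; split; first exact: card_le_trans BK.
by move=> KA; apply: KB; exact: card_le_trans AB.
Qed.

Lemma card_lt_image (T U : Type) (f : T -> U) (A : set T) :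
  card_lt A [set: K] -> card_lt (f @` A) [set: K].
Proof. exact: card_lt_le (card_image_le _ _). Qed.

Lemma card_lt_sub (T : Type) (A B : set T) : A `<=` B ->
  card_lt B [set: K] -> card_lt A [set: K].
Proof. by move=> AB; apply: card_lt_le; exact: subset_card_le. Qed.

Lemma card_lt_setT (T : Type) (A : set T) :
  card_lt A [set: K] -> card_lt [set: A] [set: K].
Proof. by move=> cA; apply: card_lt_le cA; have := card_setT A; rewrite card_eq_le => /andP[]. Qed.

Hypothesis hK : regular_cardinal K.

Lemma card_lt_finite (T : Type) (A : set T) : finite_set A -> card_lt A [set: K].
Proof.
move=> fA; split; first exact: card_le_trans (finite_set_countable fA) hK.1.
move=> KA; apply: infinite_nat.
exact: card_le_finite (card_le_trans hK.1 KA) fA.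
Qed.

(** The union is an image of the disjoint sum, for which regularity is stated. *)
Lemma card_lt_bigcup (I : smallType) (T : smallType) (A : set I) (F : I -> set T) :
  card_lt A [set: K] -> (forall i, A i -> card_lt (F i) [set: K]) ->
  card_lt (\bigcup_(i in A) F i) [set: K].
Proof.
move=> cA cF; pose J : smallType := A; pose G (i : J) : smallType := F (val i).
have cG : card_lt [set: {i : J & G i}] [set: K].
  apply: hK.2; first exact: card_lt_setT.
  by move=> i; apply: card_lt_setT; apply: cF; exact: set_valP.
apply: card_lt_le cG.
have -> : \bigcup_(i in A) F i = (fun x : {i : J & G i} => val (tagged x)) @` setT.
  apply/seteqP; split=> [t [i Ai Fit]|_ [[i t] _ <-] /=]; last first.
    by exists (val i); [exact: set_valP|exact: set_valP].
  exists (existT G (SigSub (mem_set Ai) : J) (SigSub (mem_set Fit))) => //.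
exact: card_image_le.
Qed.

Lemma directed_bound (P : poset) (J : Type) (D : set J) (p : J -> poset_sort P) :
  directed K P -> card_lt D [set: K] -> exists u, forall j, D j -> ple (p j) u.
Proof.
move=> dP cD; have [u hu] := dP _ (card_lt_image p cD).
by exists u => j Dj; apply: hu; exists j.
Qed.

Lemma directed2 (P : poset) (p q : poset_sort P) : directed K P ->
  exists u, ple p u /\ ple q u.
Proof.
move=> dP; have [|u hu] := dP [set p; q].
  by apply: card_lt_finite; exact: finite_set2.
by exists u; split; apply: hu; [left|right].
Qed.

End Cardinals.

Section Presentations.
Variable R : realType.
Implicit Types (E F Q : cborn R).

(** The bijections [b i] onto the fibres cover both uses: fibres as subtypes, and summands of a
    disjoint union. A family of morphisms is bounded on a fibre because the unit vectors of one
    summand form a bounded set. *)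
Lemma l1_coproduct (T I : smallType) (pi : T -> I) (X : l1space R pi)
    (S : I -> smallType) (b : forall i, S i -> T) :
  (forall i s, pi (b i s) = i) -> (forall i, injective (b i)) ->
  (forall t, exists s, b (pi t) s = t) ->
  exists inj : forall i, @hom (CBorn R) (CBorn_l1 R (S i)) X, is_coproduct inj.
Proof.
move=> pib b_inj b_surj.
have inj_ex i : exists f : cborn_hom (l1_space R (S i)) X,
    forall s, f (unitv _ s) = unitv X (b i s).
  apply: l1space_univ => j; apply: bounded_subset (unitv_bounded X i).
  by move=> _ [s _ <-]; exists (b i s) => //; exact: pib.
pose inj i := sval (cid (inj_ex i)).
have injE i s : inj i (unitv (l1_space R (S i)) s) = unitv X (b i s).
  exact: (svalP (cid (inj_ex i))).
exists inj => Y d.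
pose u i s : l1_space R (S i) := unitv (l1_space R (S i)) s.
have d_eq i j (s : S i) (s' : S j) : b i s = b j s' -> d i (u i s) = d j (u j s').
  move=> bb; have ij : i = j by rewrite -(pib i s) bb pib.
  by subst j; rewrite (b_inj _ _ _ bb).
pose s t := sval (cid (b_surj t)).
have sE t : b (pi t) (s t) = t by exact: (svalP (cid (b_surj t))).
pose y t := d (pi t) (u _ (s t)).
have [|h hy] := @l1space_univ R T I pi X Y y.
  move=> i; have := cborn_bounded (d i) (unitv_bounded (l1_space R (S i)) tt).
  apply: bounded_subset => _ [t /= ti <-].
  have [s0 s0E] : exists s0 : S i, b i s0 = t by rewrite -ti; exists (s t).
  by exists (u i s0); [exists s0|apply: d_eq; rewrite s0E sE].
exists h; split.
  move=> i; apply: (@l1space_eq R _ _ _ (l1_space R (S i))) => s0.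
  by rewrite /= injE hy; apply: d_eq; rewrite sE.
move=> h' h'd; apply: l1space_eq => t; rewrite hy /y -h'd /= injE.
by rewrite sE.
Qed.

Lemma coproduct_iso (I : smallType) (S : I -> CBorn R) (P P' : CBorn R)
    (inj : forall i, hom (S i) P) (inj' : forall i, hom (S i) P') :
  is_coproduct inj -> is_coproduct inj' ->
  exists (f : cborn_hom P P') (g : cborn_hom P' P), cancel f g /\ cancel g f.
Proof.
move=> hP hP'; have [f [finj _]] := hP _ inj'; have [g [ginj _]] := hP' _ inj.
exists f, g; split=> x.
  have [k [_ uk]] := hP _ inj.
  have fgE : cborn_comp g f = cborn_id P.
    transitivity k; last by apply: uk => i; exact: comp1c.
    by apply/esym/uk => i; rewrite -[RHS]ginj -finj; exact/esym/compA.
  by rewrite -[RHS](congr1 (fun f : cborn_hom P P => f x) fgE).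
have [k [_ uk]] := hP' _ inj'.
have gfE : cborn_comp f g = cborn_id P'.
  transitivity k; last by apply: uk => i; exact: comp1c.
  by apply/esym/uk => i; rewrite -[RHS]finj -ginj; exact/esym/compA.
by rewrite -[RHS](congr1 (fun f : cborn_hom P' P' => f x) gfE).
Qed.

Lemma is_cokernel_quot (E F Q : CBorn R) (g : hom E F) (q : hom F Q) :
  is_cokernel g q -> is_quot (range (g : cborn_hom E F)) (q : cborn_hom F Q).
Proof.
move=> [qg uq]; split=> [_ [v _ <-]|G f fg].
  by rewrite [LHS](congr1 (fun h : cborn_hom E Q => h v) qg).
by apply: uq; apply: cborn_hom_eq => v /=; apply: fg; exists v.
Qed.

(** [q] is the cokernel of the map from the free space on the relations. Each relation is a fibre of
    its own, so that an unbounded [N] also defines a morphism. *)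
Lemma is_quot_strict_epi (E Q : CBorn R) (N : set (cborn_space E)) (q : cborn_hom E Q) :
  is_quot N q -> @strict_epi R E Q q.
Proof.
move=> [qN uq]; pose T : smallType := N.
have [|g gE] := @l1space_univ R T T id (l1sum_space R (id : T -> T)) E (fun n : T => val n).
  by move=> i; apply: bounded_subset (bounded1 (val i)) => _ [t /= -> <-].
exists (cborn_l1sum R (id : T -> T)), g; split.
  apply: (@l1space_eq R _ _ _ (l1sum_space R (id : T -> T))) => t.
  by rewrite /= gE qN//; exact: set_valP.
move=> H h hg; apply: uq => v Nv.
have := congr1 (fun f : cborn_hom (l1sum_space R (id : T -> T)) H =>
  f (unitv _ (SigSub (mem_set Nv) : T))) hg.
by rewrite /= gE.
Qed.

Variable K : smallType.

Record presentation (B : cborn R) := Presentation {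
  gens : smallType;
  blocks : smallType;
  block : gens -> blocks;
  block_card : forall i, card_lt [set t | block t = i] [set: K];
  pres_map : cborn_hom (l1sum_space R block) B;
  rels : set (l1sum_space R block);
  pres_quot : is_quot rels pres_map }.

Lemma presentation_CBorn_lt (B : cborn R) : presentation B ->
  exists (I : smallType) (S : I -> smallType),
    (forall i, card_lt [set: S i] [set: K]) /\
    exists (P : CBorn R) (inj : forall i, hom (CBorn_l1 R (S i)) P)
      (f : @hom (CBorn R) P B), is_coproduct inj /\ strict_epi f.
Proof.
move=> [T I pi piK q N hq].
exists I, (fun i => [set t | pi t = i] : smallType); split.
  by move=> i; exact/card_lt_setT.
have [||| inj hinj] := @l1_coproduct T I pi (l1sum_space R pi)
    (fun i => [set t | pi t = i] : smallType) (fun i s => val s).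
- by move=> i s; exact: (set_valP s).
- by move=> i; exact: val_inj.
- by move=> t; have h : [set s | pi s = pi t] t by []; exists (SigSub (mem_set h)).
exists (l1sum_space R pi : cborn R), inj, q; split=> //.
exact: is_quot_strict_epi hq.
Qed.

(** The given coproduct is isomorphic to the [l1sum] over the disjoint union of the index sets; the
    range of the map whose cokernel is [f] is pulled back to give the relations. *)
Lemma CBorn_lt_presentation (B : CBorn_lt R K) :
  exists _ : presentation (sval B), True.
Proof.
case: B => B [I [S [SK [P [inj [f [hP [E [g /is_cokernel_quot hf]]]]]]]]] /=.
pose T : smallType := {i : I & S i}; pose pi (t : T) := tag t.
have [||| inj' hinj'] := @l1_coproduct T I pi (l1sum_space R pi) S (fun i s => existT S i s).
- by [].
- move=> i s s' h; have := projT2_eq h.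
  by rewrite (Prop_irrelevance (projT1_eq h) erefl).
- by case=> i s; exists s.
have [h [k [hK kK]]] := coproduct_iso hinj' hP.
unshelve eexists (@Presentation B T I pi _ (cborn_comp f h) (h @^-1` range g) _) => //.
  move=> i; apply: card_lt_le (SK i).
  have -> : [set t | pi t = i] = existT S i @` [set: S i].
    apply/seteqP; split=> [[j s] /= <-|_ [s _ <-]//]; by exists s.
  exact: card_image_le.
exact: is_quot_transport hK kK.
Qed.

End Presentations.

(** * Colimits *)

Lemma colimit_iso (J C : category) (F : functor J C) (X X' : C)
    (c : cocone F X) (c' : cocone F X') : is_colimit c -> is_colimit c' ->
  exists (f : hom X X') (g : hom X' X),
    [/\ forall j, comp f (c j) = c' j, forall j, comp g (c' j) = c j,
        comp g f = idc X & comp f g = idc X'].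
Proof.
move=> hc hc'; have [f [fc _]] := hc _ c'; have [g [gc _]] := hc' _ c.
exists f, g; split=> //.
  have [k [_ uk]] := hc _ c; transitivity k; last by apply: uk => j; exact: comp1c.
  by apply/esym/uk => j; rewrite -compA fc gc.
have [k [_ uk]] := hc' _ c'; transitivity k; last by apply: uk => j; exact: comp1c.
by apply/esym/uk => j; rewrite -compA gc fc.
Qed.

Section Diagram.
Variables (R : realType) (K : smallType) (J : smallType) (Js : category_on J).
Local Notation C := (CBorn_lt R K).
Variable F : functor (Category Js) C.

Definition lt_fun (A B : C) (f : hom A B) : cborn_hom (sval A) (sval B) := f.

Definition obj_of (B : cborn R) (p : presentation K B) : C :=
  exist _ (B : CBorn R) (presentation_CBorn_lt p).

Definition diag_pres (j : J) : presentation K (sval (F j)) :=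
  sval (cid (CBorn_lt_presentation (F j))).

Definition diag_gens : smallType := {j : J & gens (diag_pres j)}.
Definition diag_blocks : smallType := {j : J & blocks (diag_pres j)}.
Definition diag_block (t : diag_gens) : diag_blocks :=
  existT _ (tag t) (block (tagged t)).

Lemma diag_block_card i : card_lt [set t | diag_block t = i] [set: K].
Proof.
case: i => j i; apply: card_lt_sub (card_lt_image (existT _ j) (block_card i)).
by move=> [j' t] /= h; have ? := projT1_eq h; simpl in *; subst j';
  exists t => //=; have := projT2_eq h; rewrite (Prop_irrelevance (projT1_eq h) erefl).
Qed.

Definition diag_sum := l1sum_space R diag_block.

Definition diag_gen (t : diag_gens) : cborn_space (sval (F (tag t))) :=
  pres_map (diag_pres (tag t)) (unitv _ (tagged t)).

Lemma diag_incl_ex j : exists f : cborn_hom (l1sum_space R (@block _ _ _ (diag_pres j))) diag_sum,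
  forall t, f (unitv _ t) = unitv diag_sum (existT _ j t).
Proof.
apply: l1space_univ => i.
apply: bounded_subset (unitv_bounded diag_sum (existT _ j i)) => _ [t /= <- <-].
by exists (existT _ j t).
Qed.

Definition diag_incl j := sval (cid (diag_incl_ex j)).

Lemma diag_inclE j t : diag_incl j (unitv _ t) = unitv diag_sum (existT _ j t).
Proof. exact: (svalP (cid (diag_incl_ex j))). Qed.

Lemma diag_sum_eq (Y : cborn R) (f g : cborn_hom diag_sum Y) :
  (forall j x, f (diag_incl j x) = g (diag_incl j x)) -> f = g.
Proof.
move=> fg; apply: (@l1space_eq _ _ _ _ diag_sum) => -[j t].
by rewrite -diag_inclE fg.
Qed.

(** The family [h] is arbitrary, not a cocone: the projections to one stage of a directed diagram
    arise in this way too. *)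
Lemma diag_univ (Y : cborn R) (h : forall j, cborn_hom (sval (F j)) Y) :
  exists rho : cborn_hom diag_sum Y,
    forall j x, rho (diag_incl j x) = h j (pres_map (diag_pres j) x).
Proof.
have [|rho hrho] := @l1space_univ _ _ _ _ diag_sum Y (fun t => h (tag t) (diag_gen t)).
  move=> [j i]; pose f := cborn_comp (h j) (pres_map (diag_pres j)).
  apply: bounded_subset (cborn_bounded f (unitv_bounded (l1sum_space R _) i)).
  move=> _ [[j' t] /= e <-]; have ? := projT1_eq e; simpl in *; subst j'.
  exists (unitv (l1sum_space R (@block _ _ _ (diag_pres j))) t) => //; exists t => //=.
  by have := projT2_eq e; rewrite (Prop_irrelevance (projT1_eq e) erefl).
exists rho => j x.
have -> : rho (diag_incl j x) = cborn_comp rho (diag_incl j) x by [].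
have -> : cborn_comp rho (diag_incl j) = cborn_comp (h j) (pres_map (diag_pres j)).
  by apply: (@l1space_eq _ _ _ _ (l1sum_space R _)) => t; rewrite /= diag_inclE hrho.
by [].
Qed.

(** The condition compares lifts to the spaces of generators, through which the objects of the
    diagram are accessible. *)
Lemma diag_cocone (Y : C) (rho : cborn_hom diag_sum (sval Y)) :
  (forall (i j : Category Js) (u : hom i j) x y,
    pres_map (diag_pres j) y = lt_fun (fmap F u) (pres_map (diag_pres i) x) ->
    rho (diag_incl j y) = rho (diag_incl i x)) ->
  exists c : cocone F Y, forall j x,
    lt_fun (c j) (pres_map (diag_pres j) x) = rho (diag_incl j x).
Proof.
move=> hrho.
have k_ex j : exists k : cborn_hom (sval (F j)) (sval Y),
    forall x, k (pres_map (diag_pres j) x) = rho (diag_incl j x).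
  have [|k hk] := is_quot_lift (f := cborn_comp rho (diag_incl j)) (pres_quot (diag_pres j)).
    move=> v /(pres_quot (diag_pres j)).1 v0 /=.
    (* For the identity arrow and [x = 0] the hypothesis says that [rho] vanishes on the relations
       of [F j]. *)
    rewrite (hrho _ _ (idc (j : Category Js)) 0 v); first by rewrite !linear0.
    by rewrite v0 !linear0.
  by exists k.
pose k j : hom (F j) Y := sval (cid (k_ex j)).
have kE j x : lt_fun (k j) (pres_map (diag_pres j) x) = rho (diag_incl j x).
  exact: (svalP (cid (k_ex j))).
unshelve eexists (@Cocone _ _ F Y k _).
  move=> i j u; apply: (is_quot_uniq (pres_quot (diag_pres i))) => x.
  have [y hy] := (is_quot_bornological (pres_quot (diag_pres j))).1
    (lt_fun (fmap F u) (pres_map (diag_pres i) x)).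
  transitivity (lt_fun (k j) (lt_fun (fmap F u) (pres_map (diag_pres i) x))) => //.
  by rewrite -hy kE (hrho _ _ u x y hy); exact/esym/kE.
exact: kE.
Qed.

(** Although [Y] ranges over all objects, this is a subset of one space and so a set of relations;
    the factorisation of every cocone through the quotient is built in. *)
Definition killed_by_cocones : set diag_sum := [set e | forall (Y : C) (d : cocone F Y)
  (rho : cborn_hom diag_sum (sval Y)),
  (forall j x, rho (diag_incl j x) = lt_fun (d j) (pres_map (diag_pres j) x)) ->
  rho e = 0].

Lemma diag_colimit : exists (X : C) (c : cocone F X) (q : cborn_hom diag_sum (sval X)),
  [/\ is_colimit c, bornological_quot q &
      forall j x, q (diag_incl j x) = lt_fun (c j) (pres_map (diag_pres j) x)].
Proof.
have [Q [q [hq bq]]] := is_quot_exists killed_by_cocones.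
pose X := obj_of (Presentation diag_block_card hq).
have [|c hc] := @diag_cocone X q.
  (* Lifts related by an arrow have the same image under every cocone, so their difference is one of
     the relations. *)
  move=> i j u x y xy; apply/eqP; rewrite -subr_eq0 -linearB; apply/eqP/hq.1.
  move=> Y d rho hrho; rewrite linearB /= !hrho xy.
  have -> : lt_fun (d j) (lt_fun (fmap F u) (pres_map (diag_pres i) x)) =
    lt_fun (comp (d j) (fmap F u)) (pres_map (diag_pres i) x) by [].
  by rewrite legM subrr.
exists X, c, q; split=> //.
move=> Y d; have [rho hrho] := diag_univ (fun j => lt_fun (d j)).
have [|k kq] := is_quot_lift (f := rho) hq.
  by move=> v; apply; exact: hrho.
exists k; split.
  move=> j; apply: (is_quot_uniq (pres_quot (diag_pres j))) => x.
  transitivity (k (lt_fun (c j) (pres_map (diag_pres j) x))) => //.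
  by rewrite hc kq hrho.
move=> k' k'd; apply: (is_quot_uniq hq) => v; rewrite kq.
have -> : (k' : cborn_hom Q _) (q v) = cborn_comp (k' : cborn_hom Q _) q v by [].
congr (cborn_fun _ v); apply: diag_sum_eq => j x; rewrite hrho -k'd /=.
by rewrite -hc.
Qed.

(** The lifting of bounded sets passes from the constructed colimit to any other through the
    canonical isomorphism. *)
Lemma colimit_lift (X : C) (c : cocone F X) (rho : cborn_hom diag_sum (sval X)) :
  is_colimit c ->
  (forall j x, rho (diag_incl j x) = lt_fun (c j) (pres_map (diag_pres j) x)) ->
  bornological_quot rho.
Proof.
move=> hc hrho; have [X' [c' [q [hc' [sq bq] qE]]]] := diag_colimit.
have [f [g [fc gc gf fg]]] := colimit_iso hc' hc.
have rhoE : rho = cborn_comp (lt_fun f) q.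
  by apply: diag_sum_eq => j x; rewrite hrho /= qE -fc.
have fgK y : lt_fun f (lt_fun g y) = y.
  by rewrite -[RHS](congr1 (fun h : hom X X => lt_fun h y) fg).
split=> [y|A bA].
  by have [x hx] := sq (lt_fun g y); exists x; rewrite rhoE /= hx fgK.
have [A' bA' AA'] := bq _ (cborn_bounded (lt_fun g) bA); exists A' => // y Ay.
have /AA'[x A'x hx] : (lt_fun g @` A) (lt_fun g y) by exists y.
by exists x => //; rewrite rhoE /= hx fgK.
Qed.

End Diagram.

Lemma CBorn_lt_cocomplete (R : realType) (K : smallType) : cocomplete (CBorn_lt R K).
Proof. by move=> J Js F; have [X [c [_ [hc _ _]]]] := diag_colimit F; exists X, c. Qed.

(** * Directed colimits *)

Section FiniteSpan.
Variables (R : realType) (V : lmodType R).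

Fixpoint lspan (s : seq V) : set V :=
  if s is e :: s' then [set v | exists a : R, lspan s' (v - a *: e)] else [set 0].

Lemma lspan_lin s (a : R) v w : lspan s v -> lspan s w -> lspan s (a *: v + w).
Proof.
elim: s v w => [|e s IH] v w /=; first by move=> -> ->; rewrite scaler0 addr0.
move=> [b hb] [c hc]; exists (a * b + c).
by rewrite scalerDl -scalerA opprD addrACA -scalerBr; exact: IH.
Qed.

Lemma lspan0 s : lspan s 0.
Proof. by elim: s => //= e s IH; exists 0; rewrite scale0r subr0. Qed.

Lemma lspan_sum (T : Type) (s : seq T) (a : T -> R) (y : T -> V) :
  lspan (map y s) (\sum_(t <- s) a t *: y t).
Proof.
elim: s => [|t s IH] /=; first by rewrite big_nil.
by exists (a t); rewrite big_cons addrAC subrr add0r.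
Qed.

Lemma lspan_ind (s : seq V) (W : set V) : W 0 ->
  (forall (a : R) v w, W v -> W w -> W (a *: v + w)) ->
  (forall e, e \in s -> W e) -> lspan s `<=` W.
Proof.
move=> W0 Wl; elim: s => [|e s IH] We v /=; first by move->.
move=> [a /IH h]; rewrite -[v](subrK (a *: e)) addrC; apply: Wl.
  by apply: We; rewrite inE eqxx.
by apply: h => w ws; apply: We; rewrite inE ws orbT.
Qed.

(** Either [W] lies in the span of the tail, or some [w] in [W] has a non-zero coefficient at [e],
    and subtracting multiples of [w] brings every vector of [W] into the span of the tail. The
    generators obtained belong to [W] itself. *)
Lemma lspan_subspace (s : seq V) (W : set V) : W 0 ->
  (forall (a : R) v w, W v -> W w -> W (a *: v + w)) -> W `<=` lspan s ->
  exists s' : seq V, (forall e, e \in s' -> W e) /\ W `<=` lspan s'.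
Proof.
elim: s W => [|e s IH] W W0 Wl Ws; first by exists [::].
have [||//|s' [s'W Ws']] := IH (W `&` lspan s).
- by split=> //; exact: lspan0.
- by move=> a v w [Wv sv] [Ww sw]; split; [exact: Wl|exact: lspan_lin].
have [Wsub|] := pselect (W `<=` lspan s).
  exists s'; split=> [v /s'W[]//|v Wv]; apply: Ws'; split=> //; exact: Wsub.
move=> /existsNP[w /not_implyP[Ww nsw]]; have [a haw] := Ws _ Ww.
have a0 : a != 0.
  by apply: contra_notN nsw => /eqP a0; move: haw; rewrite a0 scale0r subr0.
exists (w :: s'); split.
  by move=> v; rewrite inE => /orP[/eqP ->//|/s'W[]].
move=> v Wv /=; have [b hbv] := Ws _ Wv; exists (b / a); apply: Ws'.
rewrite addrC -scaleNr; split; first exact: Wl.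
have -> : - (b / a) *: w + v = - (b / a) *: (w - a *: e) + (v - b *: e).
  rewrite scalerBr scalerA mulNr divfK// (scaleNr b e) opprK.
  by rewrite addrACA subrr addr0.
exact: lspan_lin.
Qed.

End FiniteSpan.

Section DirectedColimit.
Variables (R : realType) (K : smallType).
Hypothesis hK : regular_cardinal K.
Local Notation C := (CBorn_lt R K).
Variables (P : poset) (F : functor (poset_category P) C).
Hypothesis dP : directed K P.

Local Notation FJ :=
  (F : functor (Category (cat_str (poset_category P))) C).
Local Notation E := (diag_sum FJ).
Local Notation pm p := (pres_map (diag_pres FJ p)).
Local Notation incl p := (@diag_incl R K _ _ FJ p).

Definition trans p q (h : ple p q) : cborn_hom (sval (F p)) (sval (F q)) :=
  lt_fun (fmap F (h : @hom (poset_category P) p q)).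

Lemma transM p q r (pq : ple p q) (qr : ple q r) (pr : ple p r) x :
  trans qr (trans pq x) = trans pr x.
Proof.
have e : comp (qr : @hom (poset_category P) q r) (pq : @hom (poset_category P) p q) = pr.
  exact: bool_irrelevance.
by rewrite /trans -e fmapM.
Qed.

Lemma leg_trans (X : C) (c : cocone F X) p q (pq : ple p q) x :
  lt_fun (c q) (trans pq x) = lt_fun (c p) x.
Proof. by rewrite -(legM c (pq : @hom (poset_category P) p q)). Qed.

(** Summands at stages below [q] are moved to [q]. The value 0 on the others is arbitrary, and
    harmless once [q] dominates all stages that a vector involves. *)
Lemma proj_ex q : exists f : cborn_hom E (sval (F q)),
  forall p x, (forall pq : ple p q, f (incl p x) = trans pq (pm p x)) /\
              (~ ple p q -> f (incl p x) = 0).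
Proof.
pose h p : cborn_hom (sval (F p)) (sval (F q)) :=
  if pselect (ple p q) is left pq then trans pq else cborn_zero _ _.
have [f fE] := @diag_univ R K _ _ FJ _ h.
exists f => p x; rewrite fE /h; case: pselect => [pq|npq]; split=> // pq'.
by congr (cborn_fun (trans _) _); exact: bool_irrelevance.
Qed.

Definition proj q := sval (cid (proj_ex q)).

Lemma projE p q (pq : ple p q) x : proj q (incl p x) = trans pq (pm p x).
Proof. exact: (svalP (cid (proj_ex q)) p x).1. Qed.

(** All later stages have to kill the vector: a single one would not do, since [proj q] also kills
    the summands at stages not below [q]. *)
Definition dying : set E := [set e | exists q, forall q', ple q q' -> proj q' e = 0].

Lemma dying_lin (a : R) v w : dying v -> dying w -> dying (a *: v + w).
Proof.
move=> [p hp] [q hq]; have [r [pr qr]] := directed2 hK p q dP; exists r => r' rr'.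
by rewrite linearD linearZ /= hp ?hq ?scaler0 ?addr0//; exact: ple_trans rr'.
Qed.

Lemma dying0 : dying 0.
Proof.
have [|q _] := dP (A := set0).
  exact: (@card_lt_finite K hK _ (@set0 (poset_sort P)) (finite_set0 _)).
by exists q => q' _; rewrite linear0.
Qed.

Lemma small_finite (T : Type) (A : set T) : ~ card_lt [set: nat] [set: K] ->
  card_lt A [set: K] -> finite_set A.
Proof.
move=> nK [AK KA]; apply: contrapT => iA.
have natA : [set: nat] #<= A by exact/infiniteP.
by apply: nK; split; [exact: hK.1|move=> /card_le_trans/(_ natA)].
Qed.

(** For countable [K] directedness gives no common stage for infinitely many vectors. The dying
    vectors over [J] then form a subspace of finite dimension, and the stages of finitely many
    generators suffice; these generators must be dying themselves, whence [lspan_subspace]. *)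
Lemma dying_seq (x : nat -> E) (J : {fset {classic (diag_blocks FJ)}}) :
  (forall n, dying (x n)) ->
  (forall n t, coef (x n) t != 0 -> (diag_block t : {classic _}) \in J) ->
  exists q, forall q', ple q q' -> forall n, proj q' (x n) = 0.
Proof.
move=> xd xJ; have [natK|natK] := pselect (card_lt [set: nat] [set: K]).
  have /choice[q hq] := xd.
  have [u hu] := directed_bound q dP natK; exists u => q' uq' n.
  by apply: hq; apply: ple_trans uq'; exact: hu.
pose S : set {classic (diag_gens FJ)} :=
  \bigcup_(i in [set` J]) [set t | (diag_block t : {classic _}) = i].
have fS : finite_set S.
  apply: bigcup_finite => [|i _]; first exact: finite_fset.
  exact: small_finite natK (diag_block_card i).
pose W := [set v | dying v /\ forall t, coef v t != 0 -> (diag_block t : {classic _}) \in J].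
pose s := map (unitv E) (fset_set S).
have Ws : W `<=` lspan s.
  move=> v [_ vJ]; have -> : v = \sum_(t <- fset_set S) coef v t *: unitv E t.
    apply: is_sum_uniq (coef_sum v) (is_sum_fin _) => t tS.
    have [->|/vJ vt] := eqVneq (coef v t) 0; first by rewrite scale0r.
    by move: tS; rewrite in_fset_set// notin_setE => -[]; exists (diag_block t).
  exact: lspan_sum.
have Wl (a : R) v w : W v -> W w -> W (a *: v + w).
  move=> [dv vJ] [dw wJ]; split; first exact: dying_lin.
  move=> t; rewrite coef_lin; have [v0|/vJ//] := eqVneq (coef v t) 0.
  by rewrite v0 mulr0 add0r; exact: wJ.
have coef0 t : coef (0 : E) t = 0 by [].
have W0 : W 0 by split; [exact: dying0|move=> t; rewrite coef0 eqxx].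
have [s' [s'W Ws']] := lspan_subspace W0 Wl Ws.
have q_ex e : exists q, e \in s' -> forall q', ple q q' -> proj q' e = 0.
  have [es'|es'] := boolP (e \in s'); last first.
    by have [q _] := dying0; exists q.
  by have [[q hq] _] := s'W _ es'; exists q.
have /choice[q hq] := q_ex.
have [|u hu] := directed_bound (D := [set e | e \in s']) q dP.
  by apply: card_lt_finite => //; exact: finite_seq.
exists u => q' uq' n.
apply: (lspan_ind (s := s') (W := [set v | proj q' v = 0])) => /=.
- exact: linear0.
- by move=> a v w v0 w0; rewrite linearD linearZ /= v0 w0 scaler0 addr0.
- by move=> e es'; apply: hq => //; apply: ple_trans uq'; exact: hu.
- by apply: Ws'; split=> //; exact: xJ.
Qed.

Lemma dying_bclosed : bclosed dying.
Proof.
split; [exact: dying0|exact: dying_lin|].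
(* From [N] on the terms lie in the bounded set [D + l], hence over finitely many common blocks. *)
move=> D x l bD xd xl; have [N hN] := xl 1 ltr01.
have [aD _ bdD] := bD.
have [J [M hJ]] := coef_bounded (boundedD bdD (bounded1 l)).
have [||q hq] := @dying_seq (fun n => x (n + N)%N) J.
- by move=> n; exact: xd.
- move=> n; apply: (hJ _ _).1; exists (x (n + N)%N - l).
    by have := hN _ (leq_addl n N); rewrite /dil invr1 scale1r.
  by exists l => //; rewrite subrK.
exists q => q' qq'; have [_ _ kcl] := ker_bclosed (proj q').
apply: (kcl D (fun n => x (n + N)%N) l bD) => [n|]; first exact: hq.
move=> e /xl[N' hN']; exists N' => n nN'; apply: hN'.
exact: leq_trans nN' (leq_addr _ _).
Qed.

Variables (X : C) (c : cocone F X).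
Hypothesis hc : is_colimit c.

(** A bounded lift to the sum over the whole diagram meets finitely many blocks, hence finitely many
    stages; it is projected to a stage above these. *)
Lemma directed_colimit_bounded (A : set (cborn_space (sval X))) : bounded A ->
  exists p (A' : set (cborn_space (sval (F p)))), bounded A' /\ A `<=` lt_fun (c p) @` A'.
Proof.
move=> bA.
have [rho hrho] := @diag_univ R K _ _ FJ _ (fun p => lt_fun (c p)).
have [_ bq] := @colimit_lift R K _ _ FJ X c rho hc hrho.
have [B bB AB] := bq _ bA; have [J [M hJ]] := coef_bounded bB.
have [|p hp] := directed_bound (D := [set` J]) (fun i : {classic (diag_blocks _)} => tag i) dP.
  by apply: card_lt_finite => //; exact: finite_fset.
exists p, (proj p @` B); split; first exact: cborn_bounded.
move=> y /AB[e Be <-]; exists (proj p e); first by exists e.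
(* The two maps are compared only on the support of [e], whose stages all lie below [p]. *)
apply: (@l1space_ext _ _ _ _ E _ (cborn_comp (lt_fun (c p)) (proj p)) rho) => t et.
have tp : ple (tag t) p by exact: (hp _ ((hJ _ Be).1 _ et)).
case: t tp {et} => q t tp; rewrite -diag_inclE hrho.
transitivity (lt_fun (c p) (proj p (incl q (unitv _ t)))) => //.
by rewrite (projE tp) leg_trans.
Qed.

(** The sum modulo the closed subspace of dying vectors is an object of the category and receives a
    cocone. This cocone factors through the colimit, so a lift of a vector of the kernel is
    dying. *)
Lemma directed_colimit_kernel p (x : cborn_space (sval (F p))) : lt_fun (c p) x = 0 ->
  exists q (pq : ple p q), trans pq x = 0.
Proof.
pose Y : C := obj_of (Presentation (@diag_block_card _ _ _ _ FJ)
  (quot_proj_is_quot dying_bclosed)).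
have [|d hd] := @diag_cocone R K _ _ FJ Y (quot_proj dying_bclosed).
  move=> i j u v w vw; apply/eqP; rewrite -subr_eq0 -linearB; apply/eqP/quot_proj0.
  exists j => q jq; rewrite linearB /= (projE jq) vw (projE (ple_trans u jq)).
  by apply/eqP; rewrite subr_eq0; apply/eqP; exact: transM.
have [h [hcd _]] := hc d.
have [z <-] := (is_quot_bornological (pres_quot (diag_pres FJ p))).1 x.
move=> cz0; have : lt_fun (d p) (pm p z) = 0.
  by rewrite -hcd -[LHS]/(lt_fun h (lt_fun (c p) (pm p z))) cz0 linear0.
rewrite hd => /quot_proj0[q hq].
(* Above [p] the projection is the transition map on this summand; above [q] it vanishes on the
   lift. *)
have [r [pr qr]] := directed2 hK p q dP; exists r, pr.
by rewrite -projE; exact: hq.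
Qed.

End DirectedColimit.

(** * Presentable objects *)

(** Factoring through a stage defines the map out of [hom X Z]; uniqueness at a later stage makes
    its value independent of the factorisation. *)
Lemma presentable_intro (K : smallType) (C : category) (X : C) :
  regular_cardinal K ->
  (forall (P : poset) (F : functor (poset_category P) C) (Z : C) (c : cocone F Z),
    directed K P -> is_colimit c ->
    (forall h : hom X Z, exists p (g : hom X (F p)), comp (c p) g = h) /\
    (forall p (g g' : hom X (F p)), comp (c p) g = comp (c p) g' ->
      exists q (u : @hom (poset_category P) p q),
        comp (fmap F u) g = comp (fmap F u) g')) ->
  presentable K X.
Proof.
move=> hK hX P dP F Z c hc Y d; have [fac eq] := hX P F Z c dP hc.
have dM p q (u : @hom (poset_category P) p q) (g : hom X (F p)) :
    d q (comp (fmap F u) g) = d p g.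
  exact: (congr1 (fun k => k g) (legM d u)).
have d_eq p p' (g : hom X (F p)) (g' : hom X (F p')) :
    comp (c p) g = comp (c p') g' -> d p g = d p' g'.
  have [q [pq p'q]] := directed2 hK p p' dP.
  pose u : @hom (poset_category P) p q := pq.
  pose u' : @hom (poset_category P) p' q := p'q.
  rewrite -(legM c u) -(legM c u') -!compA => /eq[r [v]].
  by rewrite -(dM _ _ u) -(dM _ _ v) => ->; rewrite !dM.
pose w (h : hom X Z) := cid (fac h).
pose k (h : hom X Z) : Y := d (sval (w h)) (sval (cid (svalP (w h)))).
have kE (h : hom X Z) p (g : hom X (F p)) : comp (c p) g = h -> k h = d p g.
  move=> <-; apply: d_eq; exact: (svalP (cid (svalP (w (comp (c p) g))))).
exists k; split.
  by move=> p; apply/funext => g; exact: kE.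
move=> k' hk'; apply/funext => h; have [p [g <-]] := fac h.
by rewrite (kE _ p g)// -hk'.
Qed.

Section Presentable.
Variables (R : realType) (K : smallType).
Hypothesis hK : regular_cardinal K.
Local Notation C := (CBorn_lt R K).

(** Few generators allow a lift to a single stage, few relations a later stage where all of them
    hold. *)
Lemma small_quot_presentable (X : C) (T I : smallType) (pi : T -> I)
    (N : set (l1sum_space R pi)) (q : cborn_hom (l1sum_space R pi) (sval X)) :
  card_lt [set: T] [set: K] -> card_lt N [set: K] -> is_quot N q ->
  presentable K X.
Proof.
move=> cT cN hq; apply: presentable_intro => // P F Z c dP hc; split.
  move=> h; pose hq' : cborn_hom (l1sum_space R pi) (sval Z) := cborn_comp (lt_fun h) q.
  have block_ex i : exists p (A : set (cborn_space (sval (F p)))), bounded A /\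
      forall t, pi t = i -> exists2 y, A y & lt_fun (c p) y = hq' (unitv _ t).
    have [p [A [bA hA]]] := directed_colimit_bounded hK dP hc
      (cborn_bounded hq' (unitv_bounded (l1sum_space R pi) i)).
    exists p, A; split=> // t ti.
    have [y Ay yE] : (lt_fun (c p) @` A) (hq' (unitv _ t)).
      by apply: hA; exists (unitv (l1sum_space R pi) t) => //; exists t.
    by exists y.
  have [p hp] := choice block_ex.
  (* The bound is on [T], not on [I], so the stages are indexed by generators; a fibre without
     generators gets a trivial bounded set below. *)
  have [u hu] := directed_bound (fun t => p (pi t)) dP cT.
  have block_u i : exists B : set (cborn_space (sval (F u))), bounded B /\
      forall t, pi t = i -> exists2 y, B y & lt_fun (c u) y = hq' (unitv _ t).
    have [[t0 t0i]|npi] := pselect (exists t0, pi t0 = i); last first.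
      exists [set 0]; split; first exact: bounded1.
      by move=> t ti; case: npi; exists t.
    have [A [bA hA]] := hp i.
    have pu : ple (p i) u by rewrite -t0i; exact: hu.
    exists (trans F pu @` A); split; first exact: cborn_bounded.
    move=> t /hA[y Ay yE]; exists (trans F pu y); first by exists y.
    by rewrite leg_trans.
  have [B hB] := choice block_u.
  have y_ex t : exists y, B (pi t) y /\ lt_fun (c u) y = hq' (unitv _ t).
    by have [_ /(_ t erefl)[y By yE]] := hB (pi t); exists y.
  have [y hy] := choice y_ex.
  have [|g gE] := @l1space_univ _ _ _ _ (l1sum_space R pi) _ y.
    move=> i; have [bB _] := hB i; apply: bounded_subset bB => _ [t /= <- <-].
    exact: (hy t).1.
  have cg : cborn_comp (lt_fun (c u)) g = hq'.
    by apply: (@l1space_eq _ _ _ _ (l1sum_space R pi)) => t; rewrite /= gE (hy t).2.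
  (* [g] lifts [h] on the generators but need not kill the relations: their images vanish in the
     colimit, hence at some later stage. *)
  have r_ex n : exists r, N n -> exists ur : ple u r, trans F ur (g n) = 0.
    have [Nn|Nn] := pselect (N n); last by exists u.
    have [|r [ur r0]] := directed_colimit_kernel hK dP hc (x := g n).
      have -> : lt_fun (c u) (g n) = cborn_comp (lt_fun (c u)) g n by [].
      by rewrite cg /= hq.1// linear0.
    by exists r => _; exists ur.
  have [r hr] := choice r_ex.
  have [v0 hv0] := directed_bound r dP cN.
  have [v [uv v0v]] := directed2 hK u v0 dP.
  have [|k kE] := is_quot_lift (f := cborn_comp (trans F uv) g) hq.
    move=> n Nn; have [ur r0] := hr n Nn.
    have rv : ple (r n) v by apply: ple_trans v0v; exact: hv0.
    by rewrite /= -(transM ur rv) r0 linear0.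
  exists v, k; apply: (is_quot_uniq hq) => x.
  transitivity (lt_fun (c v) (k (q x))) => //.
  rewrite kE /= leg_trans.
  exact: (congr1 (fun f : cborn_hom (l1sum_space R pi) (sval Z) => f x) cg).
move=> p g g' cgg'.
(* A common stage is needed only for the differences at the unit vectors, fewer than [K] in number,
   since these determine the maps. *)
pose d t := lt_fun g (q (unitv (l1sum_space R pi) t)) - lt_fun g' (q (unitv _ t)).
have r_ex t : exists r, exists pr : ple p r, trans F pr (d t) = 0.
  apply: (directed_colimit_kernel hK dP hc).
  rewrite linearB /=; apply/eqP; rewrite subr_eq0; apply/eqP.
  exact: (congr1 (fun f => lt_fun f (q (unitv (l1sum_space R pi) t))) cgg').
have [r hr] := choice r_ex.
have [v0 hv0] := directed_bound r dP cT.
have [v [pv v0v]] := directed2 hK p v0 dP.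
exists v, pv; apply: (is_quot_uniq hq) => x.
have -> : (comp (fmap F (pv : @hom (poset_category P) p v)) g : cborn_hom _ _) (q x) =
  cborn_comp (cborn_comp (trans F pv) (lt_fun g)) q x by [].
have -> : (comp (fmap F (pv : @hom (poset_category P) p v)) g' : cborn_hom _ _) (q x) =
  cborn_comp (cborn_comp (trans F pv) (lt_fun g')) q x by [].
congr (cborn_fun _ x); apply: (@l1space_eq _ _ _ _ (l1sum_space R pi)) => t.
apply/eqP; rewrite -subr_eq0 /= -linearB; apply/eqP.
have [pr r0] := hr t; have rv : ple (r t) v by apply: ple_trans v0v; exact: hv0.
by rewrite -[LHS]/(trans F pv (d t)) -(transM pr rv) r0 linear0.
Qed.

End Presentable.

(** * Generators *)

Section Generators.
Variables (R : realType) (K : smallType).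
Local Notation C := (CBorn_lt R K).

(* Taking generators in [K] and labelling a fibre by itself makes the quotients
   with fewer than [K] generators and relations, up to isomorphism, a set. *)
Record gen_code := GenCode {
  code_gens : set K;
  code_block : code_gens -> set code_gens;
  code_rels : set (l1sum_space R code_block);
  code_gens_card : card_lt code_gens [set: K];
  code_rels_card : card_lt code_rels [set: K] }.

Lemma code_obj_ex (i : gen_code) : exists (X : C)
  (q : cborn_hom (l1sum_space R (@code_block i)) (sval X)), is_quot (@code_rels i) q.
Proof.
have [Q [q [hq _]]] := is_quot_exists (@code_rels i).
unshelve eexists (obj_of (@Presentation R K Q _ _ _ _ q _ hq)); last by exists q.
move=> b; apply: card_lt_sub (subsetT _) _.
exact: card_lt_setT (code_gens_card i).
Qed.

Definition code_obj i : C := sval (cid (code_obj_ex i)).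

(** Generators are renamed along an injection of [T] into [K], and the label of a fibre is replaced
    by the set of its renamed generators. *)
Lemma code_exists (T I : smallType) (pi : T -> I) (N : set (l1sum_space R pi)) :
  card_lt [set: T] [set: K] -> card_lt N [set: K] ->
  exists i (q : cborn_hom (l1sum_space R pi) (sval (code_obj i))), is_quot N q.
Proof.
move=> cT cN; have /card_leP[phi0] := cT.1.
pose phi t := val (phi0 (SigSub (mem_set (Logic.I : [set: T] t)))).
have phi_inj t t' : phi t = phi t' -> t = t'.
  move=> /val_inj tt'; have := @inj _ _ _ phi0 _ _ _ _ tt'.
  by rewrite !inE => /(_ Logic.I Logic.I)/(congr1 val).
pose S := range phi.
have phiS t : phi t \in S by rewrite inE; exists t.
pose f t : S := SigSub (phiS t).
have g_ex (s : S) : exists t, f t = s.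
  by have [t _ ts] := set_valP s; exists t; exact: val_inj.
pose g s := sval (cid (g_ex s)).
have gK s : f (g s) = s by exact: (svalP (cid (g_ex s))).
have f_inj t t' : f t = f t' -> t = t' by move=> /(congr1 val)/phi_inj.
have fK t : g (f t) = t by apply: f_inj; exact: gK.
pose bl (s : S) : set S := [set s' | pi (g s') = pi (g s)].
have bl_eq s s' : bl s = bl s' -> pi (g s) = pi (g s').
  by move=> h; have : bl s s by []; rewrite h.
have [|u uE] := @l1space_univ _ _ _ _ (l1sum_space R pi) _
    (fun t => unitv (l1sum_space R bl) (f t)).
  move=> i; have [[t0 t0i]|npi] := pselect (exists t0, pi t0 = i); last first.
    apply: bounded_subset (bounded1 0) => x [t /= ti _]; by case: npi; exists t.
  apply: bounded_subset (unitv_bounded (l1sum_space R bl) (bl (f t0))).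
  move=> _ [t /= ti <-]; exists (f t) => //=.
  by apply/seteqP; split=> s; rewrite /bl /= !fK ti t0i.
have [|v vE] := @l1space_univ _ _ _ _ (l1sum_space R bl) _
    (fun s => unitv (l1sum_space R pi) (g s)).
  move=> b; have [[s0 s0b]|nb] := pselect (exists s0, bl s0 = b); last first.
    apply: bounded_subset (bounded1 0) => x [s /= sb _]; by case: nb; exists s.
  apply: bounded_subset (unitv_bounded (l1sum_space R pi) (pi (g s0))).
  by move=> _ [s /= sb <-]; exists (g s) => //=; apply: bl_eq; rewrite sb.
have uK : cancel u v.
  have vu : cborn_comp v u = cborn_id _.
    by apply: (@l1space_eq _ _ _ _ (l1sum_space R pi)) => t; rewrite /= uE vE fK.
  by move=> x; exact: (congr1 (fun h : cborn_hom _ _ => h x) vu).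
have vK : cancel v u.
  have uv : cborn_comp u v = cborn_id _.
    by apply: (@l1space_eq _ _ _ _ (l1sum_space R bl)) => s; rewrite /= vE uE gK.
  by move=> x; exact: (congr1 (fun h : cborn_hom _ _ => h x) uv).
pose i := GenCode (card_lt_le (card_image_le phi setT) cT)
  (card_lt_image (u : _ -> l1sum_space R bl) cN).
have hq := svalP (cid (svalP (cid (code_obj_ex i)))).
exists i, (cborn_comp (sval (cid (svalP (cid (code_obj_ex i))))) u).
have -> : N = u @^-1` (u @` N).
  by apply/seteqP; split=> [x Nx|x [y Ny /(can_inj uK) <-]//]; exists x.
exact: is_quot_transport hq uK vK.
Qed.

End Generators.

(** * An object as the directed colimit of its small pieces *)

Section CanonicalDiagram.
Variables (R : realType) (K : smallType).
Hypothesis hK : regular_cardinal K.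
Local Notation C := (CBorn_lt R K).
Variables (B : C) (T I : smallType) (pi : T -> I).
Local Notation X := (l1sum_space R pi).
Variables (N0 : set X) (f : cborn_hom X (sval B)).
Hypotheses (piK : forall i, card_lt [set t | pi t = i] [set: K]) (hf : is_quot N0 f).

Definition sub_block (A : set T) (t : A) : I := pi (val t).
Local Notation XA A := (l1sum_space R (@sub_block A)).

Lemma incl_ex (A : set T) : exists u : cborn_hom (XA A) X,
  forall t, u (unitv _ t) = unitv X (val t).
Proof.
apply: l1space_univ => i; apply: bounded_subset (unitv_bounded X i).
by move=> _ [t /= ti <-]; exists (val t).
Qed.

Definition incl A := sval (cid (incl_ex A)).

Lemma inclE A t : incl A (unitv _ t) = unitv X (val t).
Proof. exact: (svalP (cid (incl_ex A))). Qed.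

(** Unit vectors outside [A] are sent to 0. Maps between pieces can then be written as an inclusion
    into the full space followed by a retraction. *)
Lemma retr_ex (A : set T) : exists u : cborn_hom X (XA A),
  forall t : A, u (unitv _ (val t)) = unitv (XA A) t.
Proof.
pose y t : XA A := if pselect (A t) is left At then unitv (XA A) (SigSub (mem_set At)) else 0.
have [|u uE] := @l1space_univ _ _ _ _ X _ y.
  move=> i; apply: bounded_subset (boundedU (unitv_bounded (XA A) i) (bounded1 0)).
  move=> _ [t /= ti <-]; rewrite /y; case: pselect => [At|nAt]; last by right.
  by left; exists (SigSub (mem_set At)).
exists u => t; rewrite uE /y; case: pselect => [At|/(_ (set_valP t))//].
by congr unitv; exact: val_inj.
Qed.

Definition retr A := sval (cid (retr_ex A)).

Lemma retrE A t : retr A (unitv X (val t)) = unitv (XA A) t.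
Proof. exact: (svalP (cid (retr_ex A))). Qed.

Lemma inclK A : cancel (incl A) (retr A).
Proof.
have h : cborn_comp (retr A) (incl A) = cborn_id _.
  by apply: (@l1space_eq _ _ _ _ (XA A)) => t; rewrite /= inclE retrE.
by move=> x; exact: (congr1 (fun h : cborn_hom _ _ => h x) h).
Qed.

Lemma retrK (A : set T) x : (forall t, coef x t != 0 -> A t) -> incl A (retr A x) = x.
Proof.
move=> xA; apply: (@l1space_ext _ _ _ _ X _ (cborn_comp (incl A) (retr A)) (cborn_id _)).
have h (s : A) : incl A (retr A (unitv X (val s))) = unitv X (val s) by rewrite retrE inclE.
by move=> t /xA At; exact: (h (SigSub (mem_set At))).
Qed.

Lemma retr_incl (A A' : set T) x : A `<=` A' -> incl A' (retr A' (incl A x)) = incl A x.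
Proof.
move=> AA'.
have h : cborn_comp (incl A') (cborn_comp (retr A') (incl A)) = incl A.
  apply: (@l1space_eq _ _ _ _ (XA A)) => t; rewrite /= !inclE.
  have At : A' (val t) by apply: AA'; exact: set_valP.
  have -> : val t = val (SigSub (mem_set At) : A') by [].
  by rewrite retrE inclE.
exact: (congr1 (fun h : cborn_hom _ _ => h x) h).
Qed.

(* A piece is a set of generators together with a set of relations; the
   relations that involve other generators have no effect. *)
Definition piece_ok (z : set T * set X) := [/\ card_lt z.1 [set: K],
  card_lt z.2 [set: K] & forall x, z.2 x -> f x = 0].

Definition piece : smallType := {z : set T * set X | piece_ok z}.

Definition piece_le (z z' : piece) :=
  `[< (sval z).1 `<=` (sval z').1 /\ (sval z).2 `<=` (sval z').2 >].

Lemma piece_le_refl : reflexive piece_le.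
Proof. by move=> z; apply/asboolP; split. Qed.

Lemma piece_le_anti : antisymmetric piece_le.
Proof.
move=> [[A N] h] [[A' N'] h'] /andP[/asboolP[/= AA' NN'] /asboolP[/= A'A N'N]].
have EA : A = A' by apply/seteqP.
have EN : N = N' by apply/seteqP.
by subst A' N'; congr exist; exact: Prop_irrelevance.
Qed.

Lemma piece_le_trans : transitive piece_le.
Proof.
move=> z' z z'' /asboolP[h1 h2] /asboolP[h3 h4]; apply/asboolP; split;
  by [exact: subset_trans h3|exact: subset_trans h4].
Qed.

Definition piece_poset := Poset piece_le_refl piece_le_anti piece_le_trans.

Lemma piece_directed : directed K piece_poset.
Proof.
move=> Z cZ.
have ok : piece_ok (\bigcup_(z in Z) (sval z).1, \bigcup_(z in Z) (sval z).2).
  split=> /=.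
  - by apply: card_lt_bigcup => // z _; have [] := svalP z.
  - by apply: card_lt_bigcup => // z _; have [] := svalP z.
  - by move=> x [z _ zx]; have [_ _] := svalP z; exact.
by exists (exist _ _ ok) => z Zz; apply/asboolP; split=> t zt; exists z.
Qed.

Definition piece_rels (z : piece) : set (XA (sval z).1) :=
  incl (sval z).1 @^-1` (sval z).2.
Arguments piece_rels : clear implicits.

Lemma piece_code (z : piece) : exists i
  (q : cborn_hom (XA (sval z).1) (sval (code_obj i : C))), is_quot (piece_rels z) q.
Proof.
have [cA cN _] := svalP z; apply: code_exists; first exact: card_lt_setT.
(* The effective relations lie among the retractions of the vectors in [z.2], so there are fewer
   than [K] of them. *)
apply: card_lt_sub (card_lt_image (retr (sval z).1) cN).
by move=> x Nx; exists (incl (sval z).1 x) => //; exact: inclK.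
Qed.

Definition piece_idx z := sval (cid (piece_code z)).
Definition piece_obj z : C := code_obj (piece_idx z).
Definition piece_map z : cborn_hom (XA (sval z).1) (sval (piece_obj z)) :=
  sval (cid (svalP (cid (piece_code z)))).

Lemma piece_quot z : is_quot (piece_rels z) (piece_map z).
Proof. exact: (svalP (cid (svalP (cid (piece_code z))))). Qed.

Lemma piece_trans_ex z z' : piece_le z z' ->
  exists k : cborn_hom (sval (piece_obj z)) (sval (piece_obj z')), forall x,
    k (piece_map z x) = piece_map z' (retr (sval z').1 (incl (sval z).1 x)).
Proof.
move=> /asboolP[AA' NN'].
have [|k kE] := is_quot_lift (f := cborn_comp (piece_map z')
  (cborn_comp (retr (sval z').1) (incl (sval z).1))) (piece_quot z).
  move=> x Nx; apply: (piece_quot z').1; rewrite /piece_rels /= retr_incl//.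
  exact: NN'.
by exists k.
Qed.

Definition piece_trans z z' (h : piece_le z z') :
  cborn_hom (sval (piece_obj z)) (sval (piece_obj z')) :=
  sval (cid (piece_trans_ex h)).

Lemma piece_transE z z' (h : piece_le z z') x :
  piece_trans h (piece_map z x) =
  piece_map z' (retr (sval z').1 (incl (sval z).1 x)).
Proof. exact: (svalP (cid (piece_trans_ex h))). Qed.

Lemma piece_trans1 z (h : piece_le z z) : piece_trans h = cborn_id _.
Proof.
by apply: (is_quot_uniq (piece_quot z)) => x; rewrite piece_transE inclK.
Qed.

Lemma piece_transM z z' z'' (h : piece_le z z') (h' : piece_le z' z'')
    (h'' : piece_le z z'') :
  piece_trans h'' = cborn_comp (piece_trans h') (piece_trans h).
Proof.
apply: (is_quot_uniq (piece_quot z)) => x.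
by rewrite /= !piece_transE retr_incl//; move/asboolP: h => [].
Qed.

Definition piece_functor : functor (poset_category piece_poset) C :=
  @Functor (poset_category piece_poset) C piece_obj
    (fun z z' h => piece_trans h : hom (piece_obj z) (piece_obj z'))
    (fun z => piece_trans1 _)
    (fun z z' z'' h' h => piece_transM _ _ _).

Lemma piece_leg_ex z : exists k : cborn_hom (sval (piece_obj z)) (sval B),
  forall x, k (piece_map z x) = f (incl (sval z).1 x).
Proof.
have [|k kE] := is_quot_lift (f := cborn_comp f (incl (sval z).1)) (piece_quot z).
  by move=> x Nx /=; have [_ _] := svalP z; exact.
by exists k.
Qed.

Definition piece_leg z : hom (piece_obj z) B := sval (cid (piece_leg_ex z)).

Lemma piece_legE z x : lt_fun (piece_leg z) (piece_map z x) = f (incl (sval z).1 x).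
Proof. exact: (svalP (cid (piece_leg_ex z))). Qed.

Lemma piece_legM z z' (h : piece_le z z') :
  cborn_comp (lt_fun (piece_leg z')) (piece_trans h) = piece_leg z.
Proof.
apply: (is_quot_uniq (piece_quot z)) => x.
rewrite /= piece_transE piece_legE retr_incl; last by move/asboolP: h => [].
exact/esym/piece_legE.
Qed.

Definition piece_cocone : cocone piece_functor B :=
  @Cocone _ _ piece_functor B piece_leg (fun z z' h => piece_legM h).

Lemma piece_of_ok (A : set T) (N : set X) : card_lt A [set: K] ->
  card_lt N [set: K] -> (forall x, N x -> f x = 0) -> exists z : piece, sval z = (A, N).
Proof. by move=> cA cN Nf; have h : piece_ok (A, N) by []; exists (exist _ _ h). Qed.

(** Three kinds of pieces decide everything: a single generator determines the map, a whole fibre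
    makes it bounded there, and the fibres met by a vector [x] with [f x = 0], taken with the
    relation [x], show that it kills [x]. *)
Lemma piece_colimit : is_colimit piece_cocone.
Proof.
move=> Y d.
(* Extending each leg to [X] by retraction lets different legs be compared on the same vector. *)
pose D z : cborn_hom X (sval Y) := cborn_comp (lt_fun (d z))
  (cborn_comp (piece_map z) (retr (sval z).1)).
have DM z z' x : piece_le z z' -> D z' (incl (sval z).1 x) = D z (incl (sval z).1 x).
  move=> h; rewrite /D /= inclK -(legM d (h : @hom (poset_category piece_poset) z z')).
  transitivity (lt_fun (d z') (piece_trans h (piece_map z x))) => //.
  by rewrite piece_transE.
have set0K (U : Type) : card_lt (@set0 U) [set: K].
  exact: (@card_lt_finite K hK U set0 (finite_set0 _)).
have pt_ex t : exists z : piece, sval z = ([set t], set0).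
  by apply: piece_of_ok => //; exact: (@card_lt_finite K hK _ _ (finite_set1 t)).
have [pt ptE] := choice pt_ex.
pose y t := D (pt t) (unitv X t).
have yE z t : (sval z).1 t -> D z (unitv X t) = y t.
  move=> zt; have h : (sval (pt t)).1 t by rewrite ptE.
  have -> : unitv X t = incl (sval (pt t)).1 (unitv _ (SigSub (mem_set h))).
    by rewrite inclE.
  rewrite DM ?inclE//; apply/asboolP; rewrite ptE; split=> //=.
  by move=> _ ->.
have [|h0 h0E] := @l1space_univ _ _ _ _ X (sval Y) y.
  (* A fibre has fewer than [K] generators and so fits into one piece, whose leg bounds [y] on
     it. *)
  move=> i; have [z zE] : exists z : piece, sval z = ([set t | pi t = i], set0).
    by apply: piece_of_ok.
  apply: bounded_subset (cborn_bounded (D z) (unitv_bounded X i)).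
  move=> _ [t /= ti <-]; exists (unitv X t); first by exists t.
  by apply: yE; rewrite zE.
have h0D z x : h0 (incl (sval z).1 x) = lt_fun (d z) (piece_map z x).
  have e : cborn_comp h0 (incl (sval z).1) = cborn_comp (lt_fun (d z)) (piece_map z).
    apply: (@l1space_eq _ _ _ _ (XA (sval z).1)) => t.
    by rewrite /= inclE h0E -(yE z) ?/D /= ?retrE//; exact: set_valP.
  exact: (congr1 (fun g : cborn_hom _ _ => g x) e).
have h0f x : f x = 0 -> h0 x = 0.
  move=> fx; have [J [M hJ]] := coef_bounded (bounded1 x).
  (* Finitely many fibres with fewer than [K] elements each: by regularity [A] also has fewer than
     [K]. *)
  pose A := \bigcup_(i in [set` J]) [set t | pi t = i].
  have [z zE] : exists z : piece, sval z = (A, [set x]).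
    apply: piece_of_ok => [||_ ->//].
      apply: (card_lt_bigcup hK) => [|i _]; last exact: piK.
      by apply: (@card_lt_finite K hK); exact: finite_fset.
    exact: (@card_lt_finite K hK _ _ (finite_set1 x)).
  have xA : incl (sval z).1 (retr (sval z).1 x) = x.
    apply: retrK => t xt; rewrite zE; exists (pi t) => //=.
    exact: (hJ x erefl).1.
  rewrite -xA h0D (piece_quot z).1 ?linear0//.
  by rewrite /piece_rels /= xA zE.
have [|h hE] := is_quot_lift (f := h0) hf.
  by move=> x Nx; apply: h0f; exact: hf.1.
exists h; split.
  move=> z; apply: (is_quot_uniq (piece_quot z)) => x.
  transitivity (h (lt_fun (piece_leg z) (piece_map z x))) => //.
  by rewrite piece_legE hE h0D.
move=> h' h'd; apply: (is_quot_uniq hf) => x; rewrite hE.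
have e : cborn_comp (h' : cborn_hom (sval B) (sval Y)) f = h0.
  apply: (@l1space_eq _ _ _ _ X) => t.
  have ht : (sval (pt t)).1 t by rewrite ptE.
  have -> : unitv X t = incl (sval (pt t)).1 (unitv _ (SigSub (mem_set ht))).
    by rewrite inclE.
  by rewrite h0D /= -piece_legE -h'd.
by rewrite -e.
Qed.

End CanonicalDiagram.

Theorem theorem1 (R : realType) (K : smallType) (hK : regular_cardinal K) :
  locally_presentable K (CBorn_lt R K).
Proof.
split; first exact: CBorn_lt_cocomplete.
exists (gen_code R K), (@code_obj R K); split.
  move=> i; have hq := svalP (cid (svalP (cid (code_obj_ex i)))).
  apply: small_quot_presentable hq => //; last exact: code_rels_card.
  exact/card_lt_setT/code_gens_card.
move=> B; have [[T I pi piK f N hf] _] := CBorn_lt_presentation B.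
exists (piece_poset f), (piece_functor f), (piece_cocone f); split.
- exact: piece_directed.
- by move=> z; exists (piece_idx z).
- exact: piece_colimit piK hf.
Qed.
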